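(* Suppose $n=\mu m$ and $k^*=\kappa n$, where $\mu>0$ and $\kappa\in(0,1)$ are fixed and $n$ is large, and let $\delta\in(0,1)$ be small enough. Set $$\Delta=4\log(9en/k^* )+4\log(1/\delta),\qquad \rho=\frac{\Delta}{m}+\frac{\Delta}{\sqrt{k^*m(\Delta+4/e)}},$$ $$\theta_\phi=\left(2\sqrt{\frac{k^*(\Delta+4/e)}{m}}+\frac{k^*(\Delta+4/e)}{m}+2\sqrt{\frac{\log(1/\delta)}{m}}\right)\left(1-2\sqrt{\frac{\log(1/\delta)}{m}}\right)^{-1},$$ $$\beta(\mu,\kappa)=\frac{\vartheta(c)}{c}\quad\text{where}\quad c=\frac{1-\mu\Delta\kappa-\frac{\sqrt{\mu\kappa}}{\sqrt{\Delta+4/e}}-2\sqrt{\frac{\log(1/\delta)}{m}}}{\mu\Delta+\frac{\mu\Delta}{\sqrt{\kappa(\Delta+4/e)}}},$$ with $c>0$ and $\vartheta(x)=\mathbf{E}\left[(x\xi^2-1)_+\right]$, $\xi\sim\mathcal{N}(0,1)$. Define the detection threshold $\theta_\psi$ such that $$\theta_\psi\ \ge\ \beta(\mu,\kappa)^{-1}\,\theta_\phi .$$ If $\theta>\theta_\psi$ in the Gaussian model described in the context, then the test $$\mathbf{1}_{\{\psi(\rho)>\tau_\psi\}},\qquad \tau_\psi\in[\beta(\mu,\kappa)^{-1}\tau_0,\ \tau_1],$$ based on the statistic $\psi(\rho)$ discriminates between $\mathcal{H}_0$ and $\mathcal{H}_1$ with probability $1-3\delta$. Here the levels $\tau_0,\tau_1$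 are $$\tau_0=1+\sqrt{\frac{k^*(\Delta+4/e)}{m}}+\frac{4k^*}{em}+\frac{4}{e\Delta}\sqrt{\frac{k^*\Delta}{m(1+4/(e\Delta))}},$$ $$\tau_1=1+\theta-\sqrt{\frac{k^*\Delta}{m(1+4/(e\Delta))}}-\frac{k^*\Delta}{m}-2(1+\theta)\sqrt{\frac{\log(1/\delta)}{m}}.$$
   Context: Hypothesis testing problem (Gaussian model): given $m$ independent samples $x_1,\dots,x_m\in\mathbb{R}^n$, either $\mathcal{H}_0$: $x_i\sim\mathcal{N}(0,\mathbf{I}_n)$ for all $i$, or $\mathcal{H}_1$: $x_i\sim\mathcal{N}(0,\mathbf{I}_n+\theta vv^T)$ for all $i$, where $\theta>0$ and $v\in\mathbb{R}^n$ is a sparse vector with $\|v\|_2=1$ and $\mathrm{Card}(v)\le k^*$, $\mathrm{Card}(v)$ being the number of nonzero coefficients of $v$. The sample covariance matrix is $\hat\Sigma=\frac1m\sum_{i=1}^m x_ix_i^T$. The statistic $\psi(\rho)$ is computed from $\hat\Sigma$: let $A\in\mathbb{R}^{n\times n}$ satisfy $\hat\Sigma=A^TA$, with columns $a_1,\dots,a_n$; then $$\psi(\rho)=\max_{X\succeq0,\ \mathrm{Tr}(X)=1}\ \sum_{i=1}^n\mathrm{Tr}\left(X^{1/2}a_ia_i^TX^{1/2}-\rho X\right)_+,$$ where $\mathrm{Tr}(M)_+$ denotes the sum of the positive eigenvalues of the symmetric matrix $M$ and $X^{1/2}$ is the positive semidefinite square root of $X$ (the value does not depend on the choice of $A$).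 For a real number $t$, $t_+=\max\{t,0\}$, and $e$ is the base of the natural logarithm. The test decides $\mathcal{H}_1$ when the indicator equals $1$ and $\mathcal{H}_0$ otherwise; that it discriminates with probability $1-3\delta$ means that its probabilities of error under $\mathcal{H}_0$ and under $\mathcal{H}_1$ sum to at most $3\delta$. *)

(* Defs.v *)
From HB Require Import structures.
From mathcomp Require Import all_boot all_order all_algebra.
From mathcomp Require Import all_classical all_reals all_analysis.

Set Implicit Arguments.
Unset Strict Implicit.
Unset Printing Implicit Defensive.
Import Order.TTheory GRing.Theory Num.Theory.
Import numFieldNormedType.Exports.

Local Open Scope classical_set_scope.
Local Open Scope ring_scope.

Definition norm2 {R : realType} {n : nat} (v : 'cV[R]_n) : R :=
  Num.sqrt (\sum_(i < n) v i 0 ^+ 2).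

Definition Card {R : realType} {n : nat} (v : 'cV[R]_n) : nat :=
  #|[pred i : 'I_n | v i 0 != 0]|.

Definition psd {R : realType} {n : nat} (X : 'M[R]_n) : Prop :=
  X^T = X /\ forall u : 'cV[R]_n, 0 <= (u^T *m X *m u) 0 0.

(* For psd X such an S exists and is unique; 0 is the default otherwise. *)
Definition psd_sqrt {R : realType} {n : nat} (X : 'M[R]_n) : 'M[R]_n :=
  xget 0 [set S : 'M[R]_n | psd S /\ S *m S = X].

(* The eigenvalues listed with multiplicity, when the characteristic polynomial
   splits over R, as it does for symmetric M; the order of the list is
   unspecified. *)
Definition eigenvalues {R : realType} {n : nat} (M : 'M[R]_n) : seq R :=
  xget [::] [set s : seq R | char_poly M = \prod_(a <- s) ('X - a%:P)].

Definition trace_pos {R : realType} {n : nat} (M : 'M[R]_n) : R :=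
  \sum_(a <- eigenvalues M) Num.max a 0.

Definition psi_obj {R : realType} {n : nat} (A : 'M[R]_n) (rho : R)
    (X : 'M[R]_n) : R :=
  \sum_(i < n) trace_pos
    (psd_sqrt X *m col i A *m (col i A)^T *m psd_sqrt X - rho *: X).

(* The feasible set is compact and nonempty for 0 < n, and the objective is
   continuous, so that the supremum is a maximum. *)
Definition psi_factor {R : realType} {n : nat} (A : 'M[R]_n) (rho : R) : R :=
  sup [set psi_obj A rho X | X in [set X : 'M[R]_n | psd X /\ \tr X = 1]].

(* The factor A is an arbitrary solution of Sigma = A^T A; one exists when Sigma
   is positive semidefinite, and the value is the same for all of them. *)
Definition psi {R : realType} {n : nat} (Sigma : 'M[R]_n) (rho : R) : R :=
  psi_factor (xget 0 [set A : 'M[R]_n | Sigma = A^T *m A]) rho.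

Definition vec {R : realType} {n : nat} (x : n.-tuple R) : 'cV[R]_n :=
  \col_(j < n) tnth x j.

Definition sample_cov {R : realType} {m n : nat} (x : 'I_m -> n.-tuple R) :
    'M[R]_n :=
  m%:R^-1 *: \sum_(i < m) (vec (x i) *m (vec (x i))^T).

Definition psi_test {R : realType} {m n : nat} (rho tau : R)
    (x : 'I_m -> n.-tuple R) : bool :=
  tau < psi (sample_cov x) rho.

(* N(0, s2) on the line. The case s2 = 0 is treated apart because
   [normal_prob m 0] is not the point mass at m. *)
Definition centered_normal {R : realType} (s2 : R) (B : set R) : \bar R :=
  if s2 == 0 then \d_(0 : R) B else normal_prob 0 (Num.sqrt s2) B.

(* x ~ N(0, Sigma): every linear form u^T x is distributed as
   N(0, u^T Sigma u). *)
Definition gaussian_vector {R : realType} {d} {T : measurableType d}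
    (P : probability T R) {n : nat} (x : {RV P >-> n.-tuple R})
    (Sigma : 'M[R]_n) : Prop :=
  forall (u : 'cV[R]_n) (B : set R), measurable B ->
    P [set w | B ((u^T *m vec (x w)) 0 0)] =
    centered_normal ((u^T *m Sigma *m u) 0 0) B.

(* Subfamilies are covered by taking B i = setT for the omitted indices. *)
Definition mutually_independent {R : realType} {d} {T : measurableType d}
    (P : probability T R) {m n : nat} (x : 'I_m -> {RV P >-> n.-tuple R}) :
    Prop :=
  forall B : 'I_m -> set (n.-tuple R), (forall i, measurable (B i)) ->
    P (\bigcap_(i in [set: 'I_m]) (x i @^-1` B i)) =
    (\prod_(i < m) P (x i @^-1` B i))%E.

Definition gaussian_sample {R : realType} {d} {T : measurableType d}
    (P : probability T R) {m n : nat} (x : 'I_m -> {RV P >-> n.-tuple R})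
    (Sigma : 'M[R]_n) : Prop :=
  mutually_independent x /\ forall i, gaussian_vector (x i) Sigma.

Definition e {R : realType} : R := expR 1.

Definition Delta {R : realType} (n : nat) (k delta : R) : R :=
  4 * ln (9 * e * n%:R / k) + 4 * ln (1 / delta).

Definition rho {R : realType} (m n : nat) (k delta : R) : R :=
  let D := Delta n k delta in
  D / m%:R + D / Num.sqrt (k * m%:R * (D + 4 / e)).

Definition theta_phi {R : realType} (m n : nat) (k delta : R) : R :=
  let D := Delta n k delta in
  (2 * Num.sqrt (k * (D + 4 / e) / m%:R) + k * (D + 4 / e) / m%:R
     + 2 * Num.sqrt (ln (1 / delta) / m%:R))
  * (1 - 2 * Num.sqrt (ln (1 / delta) / m%:R))^-1.

Definition vartheta {R : realType} (x : R) : R :=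
  \int[normal_prob (0 : R) 1]_(t in setT) Num.max (x * t ^+ 2 - 1) 0.

Definition c_beta {R : realType} (mu kappa : R) (m n : nat) (delta : R) : R :=
  let D := Delta n (kappa * n%:R) delta in
  (1 - mu * D * kappa - Num.sqrt (mu * kappa) / Num.sqrt (D + 4 / e)
     - 2 * Num.sqrt (ln (1 / delta) / m%:R))
  / (mu * D + mu * D / Num.sqrt (kappa * (D + 4 / e))).

Definition beta {R : realType} (mu kappa : R) (m n : nat) (delta : R) : R :=
  let c := c_beta mu kappa m n delta in vartheta c / c.

Definition tau0 {R : realType} (m n : nat) (k delta : R) : R :=
  let D := Delta n k delta in
  1 + Num.sqrt (k * (D + 4 / e) / m%:R) + 4 * k / (e * m%:R)
  + 4 / (e * D) * Num.sqrt (k * D / (m%:R * (1 + 4 / (e * D)))).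

Definition tau1 {R : realType} (m n : nat) (k delta theta : R) : R :=
  let D := Delta n k delta in
  1 + theta - Num.sqrt (k * D / (m%:R * (1 + 4 / (e * D)))) - k * D / m%:R
  - 2 * (1 + theta) * Num.sqrt (ln (1 / delta) / m%:R).

(* Main.v *)
Require Import Defs.
From mathcomp Require Import all_boot all_order all_algebra.
From mathcomp Require Import all_classical all_reals all_analysis.
From mathcomp Require Import measurable_realfun ring lra.
From mathcomp.real_closed Require Import complex.

(** Write D for Delta, so that D >= 4 ln (1/delta), and let mu = n / m and
    k = kappa n.  The proof separates the two error probabilities and bounds
    each of them by delta.

    Under the alternative, psi dominates the penalised sparse quadratic form:
    psi (Sigma, rho) >= v^T Sigma v - rho Card v ([lt_psi_of_form]).  Here
    v^T Sigma v is (1 + theta) / m times a chi-square variable with m degrees of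
    freedom, and its sharp lower tail ([emp_var_lower_tail]) gives
    v^T Sigma v > (1 + theta) (1 - 2 sqrt (ln (1/delta) / m)) up to an event of
    probability delta.  The level tau1 is exactly this bound minus rho k
    ([rho_mul]).

    Under the null hypothesis, psi is at most the largest eigenvalue of the
    sample covariance ([psi_le_of_form]).  Positivity of c forces
    mu kappa D < 1, while delta0, which may depend on kappa, can be chosen so
    that kappa D exceeds any prescribed constant; hence mu is small compared
    with mu kappa D.  The operator norm of Sigma - 1 is of order sqrt mu with
    overwhelming probability (a net of the sphere with exponentially many points
    and a two-sided chi-square tail at each point), so that it is at most
    sqrt (mu kappa D), and therefore
      psi <= 1 + sqrt (mu kappa D) <= tau0 <= tau0 / beta <= tau_psi,
    where 0 < beta <= 1 because (c xi^2 - 1)_+ <= c xi^2 and E xi^2 = 1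
    ([vartheta_bounds]).

    Both arguments need the rejection region to be measurable.  This comes from
    the variational form [lt_psi]: for Sigma positive semidefinite, tau < psi
    holds iff some member of a family of polynomials in the entries of Sigma is
    positive, and a union of such sets is open.  The same description yields the
    two comparison lemmas quoted above. *)

Set Implicit Arguments.
Unset Strict Implicit.
Unset Printing Implicit Defensive.
Import Order.TTheory GRing.Theory Num.Theory.
Import numFieldNormedType.Exports.

Local Open Scope classical_set_scope.
Local Open Scope ring_scope.

(** * The spectral theorem for real symmetric matrices *)

Section spectral.
Context {R : realType}.

(** Over the complex extension an eigenvalue exists; symmetry makes it equal to
    its conjugate, hence real, and a real scalar that is an eigenvalue of the
    extended matrix is already one of M. *)
Lemma sym_eigenvalue n (M : 'M[R]_n.+1) : M^T = M -> exists a, eigenvalue M a.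
Proof.
move=> symM; pose MC : 'M[R[i]]_n.+1 := map_mx (real_complex R) M.
have [a aP] := eigenvalue_closed MC (ltn0Sn n).
have realMC : MC \is a mxOver Num.real.
  by apply/mxOverP => i j; rewrite mxE; apply/complex_realP; exists (M i j).
have symMC : MC^T = MC.
    by rewrite /MC -[in RHS]symM; apply/matrixP => i j; rewrite !mxE.
have [v vM v0] := eigenvalueP aP.
have vv0 : (v *m (map_mx Num.conj v)^T) 0 0 != 0 :> R[i].
  rewrite mxE psumr_eq0; last by move=> i _; rewrite !mxE mul_conjC_ge0.
  apply: contraNN v0 => /allP v0; apply/eqP/rowP => j.
  have := v0 j (mem_index_enum _); rewrite !mxE mul_conjC_eq0.
  by move=> /eqP.
have reala : a \is Num.real.
  apply/CrealP; apply: (mulIf vv0).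
  have cM : map_mx Num.conj MC = MC by exact: realmxC.
  have E1 : a * (v *m (map_mx Num.conj v)^T) 0 0
            = (v *m MC *m (map_mx Num.conj v)^T) 0 0.
    by rewrite vM -scalemxAl [in RHS]mxE.
  have E2 : Num.conj a * (v *m (map_mx Num.conj v)^T) 0 0
            = (v *m MC *m (map_mx Num.conj v)^T) 0 0.
    rewrite -mulmxA -symMC -trmx_mul -{1}cM -map_mxM vM.
    rewrite map_mxZ.
    have -> : (Num.conj a *: map_mx Num.conj v)^T =
        Num.conj a *: (map_mx Num.conj v)^T.
      by apply/matrixP => i j; rewrite !mxE.
    by rewrite -scalemxAr [in RHS]mxE.
  by rewrite E1 E2.
exists (complex.Re a); rewrite -(eigenvalue_map (real_complex R)).
by have /= -> := RRe_real reala.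
Qed.

Lemma sumsqr_eq0 n (v : 'cV[R]_n) : (v^T *m v) 0 0 = 0 -> v = 0.
Proof.
rewrite mxE => /eqP; rewrite psumr_eq0; last first.
  by move=> i _; rewrite mxE -expr2 sqr_ge0.
move=> /allP h; apply/colP => i.
have := h i (mem_index_enum _); rewrite !mxE mulf_eq0 orbb.
by move=> /eqP.
Qed.

Lemma sumsqr_ge0 n (v : 'cV[R]_n) : 0 <= (v^T *m v) 0 0.
Proof. by rewrite mxE sumr_ge0// => i _; rewrite mxE -expr2 sqr_ge0. Qed.

Lemma dotmxC n (u v : 'cV[R]_n) : (u^T *m v) 0 0 = (v^T *m u) 0 0.
Proof. by rewrite !mxE; apply: eq_bigr => i _; rewrite !mxE mulrC. Qed.

Lemma mx11E (a : 'M[R]_1) : a = (a 0 0)%:M.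
Proof. by apply/matrixP => i j; rewrite !ord1 mxE eqxx mulr1n. Qed.

(** A reflection exchanging two unit vectors. It moves an eigenvector onto the
    first coordinate axis while keeping the matrix symmetric, which is what the
    induction in [sym_spectral] needs. *)
Lemma householder n (v w : 'cV[R]_n) :
  (v^T *m v) 0 0 = 1 -> (w^T *m w) 0 0 = 1 ->
  exists H : 'M[R]_n, [/\ H^T = H, H *m H = 1%:M & H *m v = w].
Proof.
move=> v1 w1; have [->|vw] := eqVneq v w.
  by exists 1%:M; rewrite trmx1 !mul1mx.
pose z := v - w; pose q := (z^T *m z) 0 0.
have q0 : q != 0.
  by apply: contraNneq vw => /sumsqr_eq0 /eqP; rewrite subr_eq0.
have zz : z^T *m z = q%:M by rewrite [LHS]mx11E.
have zv : z^T *m v = (q / 2)%:M.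
  rewrite [LHS]mx11E; congr (_%:M).
  have zT : z^T = v^T - w^T by rewrite /z linearB.
  rewrite /q zT {1}/z !mulmxBl mulmxBr mulmxBr !mxE.
  move: v1 w1 (dotmxC v w); rewrite !mxE => -> -> ->; lra.
pose c := 2 / q.
exists (1%:M - c *: (z *m z^T)); split.
- by rewrite linearB linearZ/= trmx1 trmx_mul trmxK.
- rewrite mulmxBl mul1mx mulmxBr mulmx1 -scalemxAl -scalemxAr.
  have -> : z *m z^T *m (z *m z^T) = q *: (z *m z^T).
    by rewrite -mulmxA (mulmxA z^T) zz mul_scalar_mx -scalemxAr.
  rewrite !scalerA (_ : c * c * q = c + c); last by rewrite /c; field.
  by rewrite scalerDl opprB addrK subrK.
- rewrite mulmxBl mul1mx -scalemxAl -mulmxA zv mul_mx_scalar scalerA.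
  rewrite (_ : c * _ = 1); last by rewrite /c; field.
  by rewrite scale1r /z subKr.
Qed.

(** Deflation: after a Householder reflection sends a unit eigenvector to the
    first axis, symmetry makes the matrix block diagonal with a scalar block. *)
Theorem sym_spectral n (M : 'M[R]_n) : M^T = M ->
  exists (U : 'M[R]_n) (d : 'rV[R]_n),
    U^T *m U = 1%:M /\ M = U *m diag_mx d *m U^T.
Proof.
elim: n M => [|n IH] M symM.
  by exists 1%:M, 0; split; apply/matrixP => -[].
have [a /eigenvalueP[w wM w0]] := sym_eigenvalue symM.
pose q := (w *m w^T) 0 0.
have q0 : 0 < q.
  have := sumsqr_ge0 w^T; rewrite trmxK -/q le0r => /orP[|//] /eqP qE.
  by case/negP: w0; rewrite -trmx_eq0; apply/eqP/sumsqr_eq0; rewrite trmxK.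
pose v : 'cV[R]_(1 + n) := (Num.sqrt q)^-1 *: w^T.
have v1 : (v^T *m v) 0 0 = 1.
  have vT : v^T = (Num.sqrt q)^-1 *: w by rewrite /v linearZ/= trmxK.
  rewrite vT /v -scalemxAl -scalemxAr scalerA mxE -/q.
  by rewrite -invfM -expr2 sqr_sqrtr ?ltW// mulVf// gt_eqF.
have Mv : M *m v = a *: v.
  have := congr1 trmx wM; rewrite trmx_mul symM linearZ/= => h.
  by rewrite /v -scalemxAr h !scalerA mulrC.
pose e0 : 'cV[R]_(1 + n) := delta_mx 0 0.
have e01 : (e0^T *m e0) 0 0 = 1.
  by rewrite trmx_delta mul_delta_mx mxE !eqxx.
have [H [HT HH Hv]] := householder v1 e01.
pose M' : 'M[R]_(1 + n) := H *m M *m H.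
have symM' : M'^T = M' by rewrite /M' !trmx_mul HT symM mulmxA.
have M'e : M' *m e0 = a *: e0.
  by rewrite -Hv /M' -!mulmxA (mulmxA H H) HH mul1mx Mv -scalemxAr.
have ME : M = H *m M' *m H.
  by rewrite /M' !mulmxA HH mul1mx -mulmxA HH mulmx1.
clearbody M'.
have M'0 i : M' i 0 = a *+ (i == 0).
  have := congr1 (fun X : 'cV__ => X i 0) M'e.
  by rewrite -colE !mxE eqxx andbT mulr_natr.
pose N := drsubmx M'.
have symN : N^T = N by rewrite /N trmx_drsub symM'.
have M'E : M' = block_mx a%:M 0 0 N.
  rewrite -[LHS]submxK; congr block_mx.
  - by rewrite [LHS]mx11E mxE mxE lshift0 M'0 eqxx.
  - apply/matrixP => i j; rewrite !mxE -{1}symM' mxE ord1 lshift0 M'0.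
    by rewrite -val_eqE.
  - by apply/matrixP => i j; rewrite !mxE ord1 lshift0 M'0 -val_eqE.
have [V [d [VV NE]]] := IH _ symN.
pose B : 'M[R]_(1 + n) := block_mx 1%:M 0 0 V.
pose D : 'rV[R]_(1 + n) := row_mx a%:M d.
have BT : B^T = block_mx 1%:M 0 0 V^T by rewrite /B tr_block_mx !trmx0 trmx1.
have BB : B^T *m B = 1%:M.
  rewrite BT mulmx_block !mulmx0 !mul0mx !addr0 !add0r mul1mx VV.
  by rewrite -scalar_mx_block.
have M'D : M' = B *m diag_mx D *m B^T.
  rewrite BT /B /D diag_mx_row !mulmx_block !mulmx0 !mul0mx !addr0 !add0r.
  rewrite !mul1mx mulmx1 -NE M'E; congr block_mx; rewrite ?mulmx0 ?mul0mx//.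
  by rewrite [RHS]mx11E !mxE.
exists (H *m B), D; split.
  by rewrite trmx_mul HT -mulmxA (mulmxA H H) HH mul1mx.
by rewrite ME M'D trmx_mul HT !mulmxA.
Qed.
End spectral.

(** * Positive semidefinite matrices and the positive part of the trace *)

Section psd_theory.
Context {R : realType}.
Implicit Types n p : nat.

Lemma orthomxC n (U : 'M[R]_n) : U^T *m U = 1%:M -> U *m U^T = 1%:M.
Proof. by move=> /mulmx1C. Qed.

Lemma psd_sym n (X : 'M[R]_n) : psd X -> X^T = X. Proof. by case. Qed.

Lemma psd_congr n p (B : 'M[R]_(n, p)) (X : 'M[R]_n) :
  psd X -> psd (B^T *m X *m B).
Proof.
case=> symX X0; split; first by rewrite !trmx_mul trmxK symX mulmxA.
by move=> u; have := X0 (B *m u); rewrite trmx_mul !mulmxA.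
Qed.

Lemma psd_congrT n p (B : 'M[R]_(p, n)) (X : 'M[R]_n) :
  psd X -> psd (B *m X *m B^T).
Proof. by move=> /(psd_congr B^T); rewrite trmxK. Qed.

Lemma psd1 n : psd (1%:M : 'M[R]_n).
Proof. by split=> [|u]; rewrite ?trmx1// mulmx1 sumsqr_ge0. Qed.

Lemma psd0 n : psd (0 : 'M[R]_n).
Proof. by split=> [|u]; rewrite ?trmx0// mulmx0 mul0mx mxE. Qed.

Lemma psd_gram n p (B : 'M[R]_(p, n)) : psd (B^T *m B).
Proof. by have := psd_congr B (psd1 p); rewrite mulmx1. Qed.

Lemma psdZ n (a : R) (X : 'M[R]_n) : 0 <= a -> psd X -> psd (a *: X).
Proof.
move=> a0 [symX X0]; split; first by rewrite linearZ/= symX.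
by move=> u; rewrite -scalemxAr -scalemxAl mxE mulr_ge0.
Qed.

Lemma psdD n (X Y : 'M[R]_n) : psd X -> psd Y -> psd (X + Y).
Proof.
move=> [symX X0] [symY Y0]; split; first by rewrite linearD/= symX symY.
by move=> u; rewrite mulmxDr mulmxDl mxE addr_ge0.
Qed.

Lemma psd_diag n (X : 'M[R]_n) i : psd X -> 0 <= X i i.
Proof.
move=> [_ /(_ (delta_mx i 0))].
by rewrite trmx_delta -rowE -colE !mxE.
Qed.

Lemma psd_tr n (X : 'M[R]_n) : psd X -> 0 <= \tr X.
Proof. by move=> Xpsd; rewrite /mxtrace sumr_ge0// => i _; exact: psd_diag. Qed.

Lemma psd_diag_mx n (d : 'rV[R]_n) : (forall i, 0 <= d 0 i) -> psd (diag_mx d).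
Proof.
move=> d0; split=> [|u]; first exact: tr_diag_mx.
rewrite -mulmxA mul_diag_mx mxE sumr_ge0// => i _.
by rewrite !mxE mulrCA mulr_ge0// -expr2 sqr_ge0.
Qed.

Lemma psd_spectral n (X : 'M[R]_n) : psd X ->
  exists (U : 'M[R]_n) (d : 'rV[R]_n), [/\ U^T *m U = 1%:M,
    X = U *m diag_mx d *m U^T & forall i, 0 <= d 0 i].
Proof.
move=> Xpsd; have [U [d [UU XE]]] := sym_spectral (psd_sym Xpsd).
exists U, d; split=> // i.
have := psd_diag i (psd_congr U Xpsd).
rewrite XE -!mulmxA UU mulmx1 mulmxA UU mul1mx.
by rewrite mxE eqxx mulr1n.
Qed.

Lemma psd_sqrtP n (X : 'M[R]_n) : psd X ->
  psd (psd_sqrt X) /\ psd_sqrt X *m psd_sqrt X = X.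
Proof.
move=> Xpsd; rewrite /psd_sqrt.
apply: (@xgetPex _ 0 [set S : 'M[R]_n | psd S /\ S *m S = X]).
have [U [d [UU XE d0]]] := psd_spectral Xpsd.
exists (U *m diag_mx (\row_i Num.sqrt (d 0 i)) *m U^T); split.
  by apply/psd_congrT/psd_diag_mx => i; rewrite mxE sqrtr_ge0.
rewrite !mulmxA -(mulmxA _ U^T U) UU mulmx1 -(mulmxA U) mulmx_diag XE.
congr (_ *m diag_mx _ *m _); apply/rowP => i.
by rewrite !mxE -expr2 sqr_sqrtr.
Qed.

Lemma psd_gramP n (X : 'M[R]_n) : psd X -> exists A : 'M[R]_n, X = A^T *m A.
Proof.
move=> /psd_sqrtP[[sS _] SS]; exists (psd_sqrt X); by rewrite sS SS.
Qed.

Lemma psd_tr_mul n (P Q : 'M[R]_n) : psd P -> psd Q -> 0 <= \tr (P *m Q).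
Proof.
move=> /psd_gramP[A ->] Qpsd.
by rewrite -mulmxA mxtrace_mulC psd_tr//; exact: psd_congrT.
Qed.

Lemma psd_tr_eq0 n (X : 'M[R]_n) : psd X -> \tr X = 0 -> X = 0.
Proof.
move=> /psd_gramP[A ->] /eqP; rewrite /mxtrace psumr_eq0; last first.
  by move=> i _; exact/psd_diag/psd_gram.
move=> /allP tr0; suff -> : A = 0 by rewrite mulmx0.
apply/matrixP => i j; have /eqP := tr0 j (mem_index_enum _).
rewrite mxE => /eqP; rewrite psumr_eq0; last first.
  by move=> k _; rewrite mxE -expr2 sqr_ge0.
by move=> /allP/(_ i (mem_index_enum _)); rewrite !mxE mulf_eq0 orbb => /eqP.
Qed.

(** All eigenvalues are nonnegative, so each of them is at most their sum. *)
Lemma psd_le_tr n (X : 'M[R]_n) : psd X -> psd ((\tr X)%:M - X).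
Proof.
move=> Xpsd; have [U [d [UU XE d0]]] := psd_spectral Xpsd.
have -> : (\tr X)%:M - X = U *m diag_mx (\row_i (\tr X - d 0 i)) *m U^T.
  rewrite (_ : diag_mx _ = (\tr X)%:M - diag_mx d).
    rewrite mulmxBr mulmxBl -XE; congr (_ - _).
    by rewrite scalar_mxC -mulmxA orthomxC// mulmx1.
  by apply/matrixP => i j; rewrite !mxE mulrnBl.
apply/psd_congrT/psd_diag_mx => i; rewrite mxE subr_ge0 XE.
rewrite mxtrace_mulC mulmxA UU mul1mx mxtrace_diag (bigD1 i)//=.
by rewrite lerDl sumr_ge0.
Qed.

(** The two factorisations of the characteristic polynomial, the one chosen in
    [eigenvalues] and the one read off an orthogonal diagonalisation, list the
    same roots up to order. *)
Lemma trace_posE n (M U : 'M[R]_n) (d : 'rV[R]_n) : U^T *m U = 1%:M ->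
  M = U *m diag_mx d *m U^T -> trace_pos M = \sum_i Num.max (d 0 i) 0.
Proof.
move=> UU ME.
have charE : char_poly M = \prod_(i < n) ('X - (d 0 i)%:P).
  pose UP := map_mx polyC U.
  have UPUP : UP^T *m UP = 1%:M.
    by rewrite /UP map_trmx -map_mxM UU map_mx1.
  have : char_poly_mx M = UP *m char_poly_mx (diag_mx d) *m UP^T.
    rewrite /char_poly_mx mulmxBr mulmxBl; congr (_ - _).
      by rewrite scalar_mxC -mulmxA (mulmx1C UPUP) mulmx1.
    by rewrite ME !map_mxM map_trmx.
  rewrite /char_poly => ->; rewrite !det_mulmx mulrAC -det_mulmx (mulmx1C UPUP).
  rewrite det1 mul1r -/(char_poly _) char_poly_trig ?diag_mx_is_trig//.
  by apply: eq_bigr => i _; rewrite mxE eqxx.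
have : exists s : seq R, char_poly M = \prod_(a <- s) ('X - a%:P).
  by exists [seq d 0 i | i <- enum 'I_n]; rewrite big_map big_enum.
move=> /(xgetPex [::])/=; rewrite -/(eigenvalues M) charE => h.
have : perm_eq [seq d 0 i | i <- enum 'I_n] (eigenvalues M).
  by apply: prod_XsubC_eq; rewrite big_map big_enum.
by move=> hp; rewrite /trace_pos -(perm_big _ hp)/= big_map big_enum.
Qed.

(** In an eigenbasis of M, the trace of P M is the sum of the eigenvalues
    weighted by the diagonal of P, whose entries lie between 0 and 1. *)
Lemma trace_pos_ge n (M P : 'M[R]_n) : M^T = M -> psd P -> psd (1%:M - P) ->
  \tr (P *m M) <= trace_pos M.
Proof.
move=> symM P0 P1; have [U [d [UU ME]]] := sym_spectral symM.
rewrite (trace_posE UU ME) {1}ME !mulmxA mxtrace_mulC !mulmxA.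
rewrite mul_mx_diag /mxtrace ler_sum// => i _; rewrite mxE.
have Q0 := psd_diag i (psd_congr U P0).
have Q1 : (U^T *m P *m U) i i <= 1.
  rewrite -subr_ge0; have := psd_diag i (psd_congr U P1).
  by rewrite mulmxBr mulmx1 mulmxBl UU !mxE eqxx.
rewrite le_max; have [d0|d0] := leP 0 (d 0 i).
  by rewrite ler_piMl.
by rewrite mulr_ge0_le0 ?orbT// ltW.
Qed.

(** The maximum is reached at the orthogonal projector on the eigenspaces with
    positive eigenvalue. *)
Lemma trace_pos_max n (M : 'M[R]_n) : M^T = M ->
  exists P, [/\ psd P, psd (1%:M - P) & \tr (P *m M) = trace_pos M].
Proof.
move=> symM; have [U [d [UU ME]]] := sym_spectral symM.
pose b : 'rV[R]_n := \row_i ((0 < d 0 i)%R)%:R.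
exists (U *m diag_mx b *m U^T); split.
- by apply/psd_congrT/psd_diag_mx => i; rewrite mxE ler0n.
- rewrite (_ : _ - _ = U *m diag_mx (\row_i (1 - b 0 i)) *m U^T).
    by apply/psd_congrT/psd_diag_mx => i; rewrite !mxE subr_ge0 lern1 leq_b1.
  rewrite (_ : diag_mx (\row_i (1 - b 0 i)) = 1%:M - diag_mx b).
    by rewrite mulmxBr mulmxBl mulmx1 orthomxC.
  by apply/matrixP => i j; rewrite !mxE mulrnBl.
- rewrite (trace_posE UU ME) {1}ME !mulmxA -(mulmxA _ U^T U) UU mulmx1.
  rewrite mxtrace_mulC !mulmxA UU mul1mx mulmx_diag mxtrace_diag.
  apply: eq_bigr => i _; rewrite !mxE.
  by case: ltP => d0; rewrite ?mul1r ?mul0r.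
Qed.

End psd_theory.

(** * A variational form of psi *)

Section psi_variational.
Context {R : realType}.
Implicit Types n : nat.

(** With X = A G A^T and q_i = A Q_i A^T, the difference between the value
    [lifted_obj A rho q] and tau times the trace of X, written in terms of
    Sigma = A^T A alone. It is homogeneous in (G, Q), which is why no
    normalisation of the trace is imposed: only its sign matters. *)
Definition dual_gap n (Sigma : 'M[R]_n) (rho tau : R) (G : 'M[R]_n)
    (Q : 'I_n -> 'M[R]_n) : R :=
  \sum_i ((Sigma *m Q i *m Sigma) i i - rho * \tr (Q i *m Sigma))
  - tau * \tr (G *m Sigma).

(** The value of the objective once each positive part of a trace has been
    replaced by its variational expression: q_i stands for X^(1/2) P_i X^(1/2)
    with 0 <= P_i <= 1, that is, for any matrix with 0 <= q_i <= X. *)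
Definition lifted_obj n (A : 'M[R]_n) (rho : R) (q : 'I_n -> 'M[R]_n) : R :=
  \sum_i ((A^T *m q i *m A) i i - rho * \tr (q i)).

Lemma scale_diagE n (a : R) (M : 'M[R]_n) i : (a *: M) i i = a * M i i.
Proof. by rewrite mxE. Qed.

Lemma conj_diagE n (A q : 'M[R]_n) i :
  \tr (q *m (col i A *m (col i A)^T)) = (A^T *m q *m A) i i.
Proof.
rewrite (mulmxA q) mxtrace_mulC trace_mx11 -[in RHS]mulmxA !mxE.
apply: eq_bigr => k _; rewrite !mxE; congr (_ * _).
by apply: eq_bigr => l _; rewrite !mxE.
Qed.

Lemma summand_sym n (A : 'M[R]_n) (rho : R) (X : 'M[R]_n) i : psd X ->
  let S := psd_sqrt X in
  (S *m col i A *m (col i A)^T *m S - rho *: X)^T =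
  S *m col i A *m (col i A)^T *m S - rho *: X.
Proof.
move=> Xpsd S; have [[symS _] _] := psd_sqrtP Xpsd.
by rewrite linearB/= linearZ/= !trmx_mul trmxK symS (psd_sym Xpsd) !mulmxA.
Qed.

Lemma tr_summand n (A : 'M[R]_n) (rho : R) (X P : 'M[R]_n) i : psd X ->
  let S := psd_sqrt X in
  \tr (P *m (S *m col i A *m (col i A)^T *m S - rho *: X)) =
  (A^T *m (S *m P *m S) *m A) i i - rho * \tr (S *m P *m S).
Proof.
move=> Xpsd S; have [_ SS] := psd_sqrtP Xpsd.
rewrite mulmxBr linearB/= -scalemxAr linearZ/= -conj_diagE; congr (_ - _ * _).
  by rewrite -[RHS]mxtrace_mulC !mulmxA -[RHS]mxtrace_mulC !mulmxA
             [RHS]mxtrace_mulC !mulmxA.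
by rewrite -SS -[RHS]mxtrace_mulC !mulmxA -[RHS]mxtrace_mulC !mulmxA.
Qed.

Lemma psi_obj_lifted n (A : 'M[R]_n) (rho : R) (X : 'M[R]_n) : psd X ->
  exists q, (forall i, psd (q i) /\ psd (X - q i)) /\
    psi_obj A rho X = lifted_obj A rho q.
Proof.
move=> Xpsd; have [Spsd SS] := psd_sqrtP Xpsd.
set S := psd_sqrt X in Spsd SS *.
have [P hP] := choice (fun i => trace_pos_max (summand_sym A rho i Xpsd)).
have symS := psd_sym Spsd.
exists (fun i => S *m P i *m S); split.
  move=> i; have [P0 P1 _] := hP i; split.
    by rewrite -{1}symS; exact: psd_congr.
  have -> : X - S *m P i *m S = S *m (1%:M - P i) *m S.
    by rewrite mulmxBr mulmxBl mulmx1 SS.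
  by rewrite -{1}symS; exact: psd_congr.
by apply: eq_bigr => i _; have [_ _ <-] := hP i; exact: tr_summand.
Qed.

(** Invertibility of X lets q_i be written as X^(1/2) P_i X^(1/2). *)
Lemma psi_obj_ge n (A : 'M[R]_n) (rho : R) (X : 'M[R]_n) q : psd X ->
  X \in unitmx -> (forall i, psd (q i) /\ psd (X - q i)) ->
  lifted_obj A rho q <= psi_obj A rho X.
Proof.
move=> Xpsd Xunit hq; have [Spsd SS] := psd_sqrtP Xpsd.
set S := psd_sqrt X in Spsd SS *.
have symS := psd_sym Spsd.
have Sunit : S \in unitmx by move: Xunit; rewrite -SS unitmx_mul => /andP[].
have symT : (invmx S)^T = invmx S by rewrite trmx_inv symS.
apply: ler_sum => i _; have [q0 q1] := hq i.
have -> : q i = S *m (invmx S *m q i *m invmx S) *m S.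
  by rewrite !mulmxA mulmxV// mul1mx mulmxKV.
rewrite -tr_summand//; apply: trace_pos_ge; first exact: summand_sym.
  by rewrite -{1}symT; exact: psd_congr.
have -> : 1%:M - invmx S *m q i *m invmx S = invmx S *m (X - q i) *m invmx S.
  by rewrite mulmxBr mulmxBl -SS !mulmxA mulVmx// mul1mx mulmxV.
by rewrite -{1}symT; exact: psd_congr.
Qed.

Lemma lifted_obj_le n (A : 'M[R]_n) (rho : R) X q : 0 <= rho -> psd X ->
  (forall i, psd (q i) /\ psd (X - q i)) ->
  lifted_obj A rho q <= \tr X * \tr (A^T *m A).
Proof.
move=> rho0 Xpsd hq; rewrite {2}/mxtrace mulr_sumr; apply: ler_sum => i _.
have [q0 q1] := hq i.
apply: (@le_trans _ _ ((A^T *m q i *m A) i i)).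
  by rewrite gerBl mulr_ge0// psd_tr.
apply: (@le_trans _ _ ((A^T *m X *m A) i i)).
  have := psd_diag i (psd_congr A q1).
  by rewrite mulmxBr mulmxBl mxE [X in _ + X]mxE subr_ge0.
have := psd_diag i (psd_congr A (psd_le_tr Xpsd)).
rewrite mulmxBr mulmxBl mxE [X in _ + X]mxE subr_ge0 => /le_trans; apply.
by rewrite scalar_mxC -mulmxA mul_scalar_mx mxE.
Qed.

Lemma psd_shift_unit n (X : 'M[R]_n) (a : R) : psd X -> 0 < a ->
  X + a%:M \in unitmx.
Proof.
move=> [symX X0] a0; rewrite -row_free_unit; apply/row_freeP.
suff : row_free (X + a%:M) by move=> /row_freeP.
rewrite -kermx_eq0; apply/rowV0P => w /sub_kermxP wX.
have : (w *m (X + a%:M) *m w^T) 0 0 = 0 by rewrite wX mul0mx mxE.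
rewrite mulmxDr mulmxDl mxE => /eqP.
have h1 : 0 <= (w *m X *m w^T) 0 0 by have := X0 w^T; rewrite trmxK.
have h2 : (w *m a%:M *m w^T) 0 0 = a * (w^T^T *m w^T) 0 0.
  by rewrite mul_mx_scalar -scalemxAl mxE trmxK.
rewrite h2 paddr_eq0// ?mulr_ge0// ?sumsqr_ge0 ?ltW//.
rewrite mulf_eq0 (gt_eqF a0)/= => /andP[_ /eqP /sumsqr_eq0].
by move=> /(congr1 trmx); rewrite trmxK trmx0.
Qed.

(** The strict inequality leaves room to move X slightly towards a multiple of
    the identity, which makes it invertible, so that [psi_obj_ge] applies. *)
Lemma lt_psi_factor n (A : 'M[R]_n) (rho tau : R) : (0 < n)%N ->
  0 <= rho -> 0 <= tau ->
  tau < psi_factor A rho <->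
  exists X q, [/\ psd X, \tr X = 1,
    forall i, psd (q i) /\ psd (X - q i) & tau < lifted_obj A rho q].
Proof.
move=> n0 rho0 tau0; rewrite /psi_factor.
have nn0 : (0 : R) < n%:R by rewrite ltr0n.
set E := [set psi_obj A rho X | X in _].
have E0 : E !=set0.
  exists (psi_obj A rho (n%:R^-1)%:M), (n%:R^-1)%:M => //=; split.
    by rewrite -scalemx1; apply: psdZ (psd1 _); rewrite invr_ge0 ler0n.
  by rewrite mxtrace_scalar -[_ *+ n]mulr_natr mulVf// gt_eqF.
split=> [/(sup_gt E0)[_ [X [Xpsd X1] <-]]|[X [q [Xpsd X1 hq tq]]]].
  by have [q [hq ->]] := psi_obj_lifted A rho Xpsd => ?; exists X, q.
set V := lifted_obj A rho q in tq.
have V0 : 0 < V by exact: le_lt_trans tq.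
(* Shrinking V by the factor 1 - eps leaves (V + tau) / 2, still above tau. *)
pose eps := (V - tau) / (2 * V).
have eps0 : 0 < eps by rewrite divr_gt0 ?mulr_gt0// subr_gt0.
have eps1 : eps < 1 by rewrite ltr_pdivrMr ?mulr_gt0//; lra.
have epsV : tau < (1 - eps) * V.
  have epsVE : eps * V = (V - tau) / 2 by rewrite /eps; field; rewrite gt_eqF.
  by rewrite mulrBl mul1r epsVE; lra.
pose X' := (1 - eps) *: X + (eps / n%:R)%:M.
have hX : psd ((1 - eps) *: X) by apply: psdZ Xpsd; rewrite subr_ge0 ltW.
have en0 : 0 < eps / n%:R by rewrite divr_gt0.
have hI : psd ((eps / n%:R)%:M : 'M[R]_n).
  by rewrite -scalemx1; apply: psdZ (psd1 _); exact: ltW.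
apply: (lt_le_trans epsV); apply: (@le_trans _ _ (psi_obj A rho X')).
  apply: (@le_trans _ _ (lifted_obj A rho (fun i => (1 - eps) *: q i))).
    rewrite /V /lifted_obj mulr_sumr ler_sum// => i _.
    by rewrite -scalemxAr -scalemxAl scale_diagE mxtraceZ mulrCA -mulrBr.
  apply: psi_obj_ge; first exact: psdD.
    exact: psd_shift_unit.
  move=> i; have [q0 q1] := hq i; split.
    by apply: psdZ q0; rewrite subr_ge0 ltW.
  rewrite /X' addrAC -scalerBr; apply: psdD hI.
  by apply: psdZ q1; rewrite subr_ge0 ltW.
apply: ub_le_sup; last first.
  exists X' => //; split; first exact: psdD.
  rewrite linearD/= linearZ/= X1 mulr1 mxtrace_scalar -[_ *+ n]mulr_natr.
  by rewrite divfK ?gt_eqF// subrK.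
exists (\tr (A^T *m A)) => _ [Y [Ypsd Y1] <-].
have [r [hr ->]] := psi_obj_lifted A rho Ypsd.
by rewrite -[leRHS]mul1r -Y1; exact: lifted_obj_le.
Qed.

Lemma gram_eq0 m n (B : 'M[R]_(m, n)) : B^T *m B = 0 -> B = 0.
Proof.
move=> B0; apply/matrixP => i j.
suff /colP/(_ i) : col j B = 0 by rewrite !mxE.
apply: sumsqr_eq0; have := congr1 (fun M : 'M[R]_n => M j j) B0.
by rewrite !mxE => h; rewrite -[RHS]h; apply: eq_bigr => k _; rewrite !mxE.
Qed.

(** Any generalised inverse of a symmetric matrix can be symmetrised. *)
Lemma sym_pinv n (S : 'M[R]_n) : S^T = S ->
  exists Z : 'M[R]_n, Z^T = Z /\ S *m Z *m S = S.
Proof.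
move=> symS; have [W SWS] : exists W, S *m W *m S = S.
  by exists (pinvmx S); rewrite mulmxKpV.
exists (2^-1 *: (W + W^T)); split.
  by rewrite linearZ/= linearD/= trmxK addrC.
rewrite -scalemxAr -scalemxAl mulmxDr mulmxDl SWS.
have -> : S *m W^T *m S = S.
  transitivity ((S *m W *m S)^T); last by rewrite SWS symS.
  by rewrite !trmx_mul symS mulmxA.
by rewrite scalerDr -scalerDl (_ : 2^-1 + 2^-1 = 1 :> R) ?scale1r//; field.
Qed.

(** The right-hand side depends on Sigma only through polynomials in its
    entries, whereas psi is defined by means of a chosen factor A. To pass from
    (X, q) to (G, Q), matrices are compressed to the range of A by means of the
    projector Pi, which does not change the terms in A^T q_i A and can only
    decrease the traces. *)
Theorem lt_psi n (Sigma : 'M[R]_n) (rho tau : R) : (0 < n)%N -> psd Sigma ->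
  0 <= rho -> 0 <= tau ->
  tau < psi Sigma rho <->
  exists G Q, (forall i, psd (Q i) /\ psd (G - Q i)) /\
    0 < dual_gap Sigma rho tau G Q.
Proof.
move=> n0 Sigma_psd rho0 tau0; rewrite /psi.
set A := xget _ _.
have AE : Sigma = A^T *m A := xgetPex 0 (psd_gramP Sigma_psd).
clearbody A; rewrite lt_psi_factor//; split.
  move=> [X [q [Xpsd X1 hq tq]]].
  have [Z [symZ SZS]] := sym_pinv (psd_sym Sigma_psd).
  pose B := Z *m A^T; pose Pi := A *m B.
  have PiA : Pi *m A = A.
    apply/eqP; rewrite -subr_eq0; apply/eqP/gram_eq0.
    have -> : Pi *m A - A = A *m (Z *m Sigma - 1%:M).
      by rewrite mulmxBr mulmx1 AE /Pi /B !mulmxA.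
    rewrite trmx_mul -mulmxA (mulmxA A^T) -AE mulmxBr mulmx1 mulmxA SZS.
    by rewrite subrr mulmx0.
  have symPi : Pi^T = Pi by rewrite /Pi /B !trmx_mul trmxK symZ mulmxA.
  have PiPi : Pi *m Pi = Pi by rewrite {2}/Pi mulmxA PiA.
  have tr_le Y : psd Y -> \tr (B *m Y *m B^T *m Sigma) <= \tr Y.
    move=> Ypsd; rewrite -subr_ge0.
    have -> : \tr (B *m Y *m B^T *m Sigma) = \tr (Y *m Pi).
      have PiE : Pi = B^T *m Sigma *m B.
        by rewrite -PiPi -{1}symPi /Pi trmx_mul AE !mulmxA.
      by rewrite PiE -!(mulmxA B) mxtrace_mulC !mulmxA.
    rewrite -linearB/= -{1}[Y]mulmx1 -mulmxBr; apply: psd_tr_mul => //.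
    have -> : 1%:M - Pi = (1%:M - Pi)^T *m (1%:M - Pi).
      have -> : (1%:M - Pi)^T = 1%:M - Pi by rewrite linearB/= trmx1 symPi.
      rewrite mulmxBl mul1mx mulmxBr mulmx1 PiPi.
      by rewrite subrr subr0.
    exact: psd_gram.
  exists (B *m X *m B^T), (fun i => B *m q i *m B^T); split.
    move=> i; have [q0 q1] := hq i; split; first exact: psd_congrT.
    by rewrite -mulmxBl -mulmxBr; exact: psd_congrT.
  rewrite subr_gt0; apply: (@le_lt_trans _ _ tau).
    by rewrite ler_piMr// -X1 tr_le.
  apply: (lt_le_trans tq); apply: ler_sum => i _; have [q0 _] := hq i.
  have -> : Sigma *m (B *m q i *m B^T) *m Sigma = A^T *m q i *m A.
    transitivity (A^T *m Pi *m q i *m (Pi^T *m A)).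
      by rewrite AE /Pi (trmx_mul A B) !mulmxA.
    by rewrite -{1}symPi -trmx_mul PiA symPi PiA.
  by rewrite lerB// ler_wpM2l// tr_le.
move=> [G [Q [hQ gap]]].
have Gpsd : psd G.
  have [q0 q1] := hQ (Ordinal n0).
  by rewrite -[G](subrK (Q (Ordinal n0))); exact: psdD.
have Xpsd : psd (A *m G *m A^T) by exact: psd_congrT.
have qpsd i : psd (A *m Q i *m A^T) by apply: psd_congrT; case: (hQ i).
have Xq i : psd (A *m G *m A^T - A *m Q i *m A^T).
  by rewrite -mulmxBl -mulmxBr; apply: psd_congrT; case: (hQ i).
set t := \tr (A *m G *m A^T).
have trE Y : \tr (Y *m Sigma) = \tr (A *m Y *m A^T).
  by rewrite AE mulmxA mxtrace_mulC mulmxA.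
have SQS i : Sigma *m Q i *m Sigma = A^T *m (A *m Q i *m A^T) *m A.
  by rewrite AE !mulmxA.
move: gap; rewrite /dual_gap trE -/t subr_gt0.
under eq_bigr => i _ do rewrite trE SQS.
move=> gap.
(* If the trace of A G A^T vanished then every A Q_i A^T would vanish too, and
   the gap could not be positive. *)
have t0 : 0 < t.
  rewrite lt_neqAle psd_tr// andbT eq_sym; apply/eqP => t0.
  have q0 i : A *m Q i *m A^T = 0.
    apply: psd_tr_eq0 => //; apply/eqP; rewrite eq_le psd_tr// andbT -t0.
    by rewrite -subr_ge0 -linearB/= psd_tr.
  move: gap; rewrite t0 mulr0 big1 ?ltxx// => i _.
  by rewrite q0 mulmx0 mul0mx mxE mxtrace0 mulr0 subr0.
exists (t^-1 *: (A *m G *m A^T)), (fun i => t^-1 *: (A *m Q i *m A^T)).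
have ti0 : 0 <= t^-1 by rewrite invr_ge0 ltW.
split.
- exact: psdZ.
- by rewrite linearZ/= mulVf// gt_eqF.
- by move=> i; rewrite -scalerBr; split; exact: psdZ.
- rewrite -(ltr_pM2r t0); apply: (lt_le_trans gap).
  rewrite /lifted_obj mulr_suml ler_sum// => i _.
  rewrite -scalemxAr -scalemxAl scale_diagE mxtraceZ mulrCA -mulrBr.
  by rewrite mulrAC mulVf ?mul1r// gt_eqF.
Qed.

(** If Sigma <= lam then Sigma^2 <= lam Sigma, so that for any admissible (G, Q)
    the sum of the diagonal entries of Sigma Q_i Sigma is at most
    tr (G Sigma^2) <= lam tr (G Sigma). *)
Lemma psi_le_of_form n (Sigma : 'M[R]_n) (rho lam tau : R) : (0 < n)%N ->
  psd Sigma -> 0 <= rho -> 0 <= tau -> lam <= tau ->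
  (forall u : 'cV[R]_n, (u^T *m Sigma *m u) 0 0 <= lam * (u^T *m u) 0 0) ->
  psi Sigma rho <= tau.
Proof.
move=> n0 Spsd rho0 tau0 lamtau hlam; rewrite leNgt; apply/negP.
move=> /(lt_psi n0 Spsd rho0 tau0) [G [Q [hQ]]].
have Gpsd : psd G.
  have [q0 q1] := hQ (Ordinal n0).
  by rewrite -[G](subrK (Q (Ordinal n0))); exact: psdD.
apply/negP; rewrite -leNgt subr_le0.
apply: (@le_trans _ _ (\tr (Sigma *m G *m Sigma))).
  apply: ler_sum => i _; have [Q0 Q1] := hQ i.
  apply: (@le_trans _ _ ((Sigma *m Q i *m Sigma) i i)).
    by rewrite gerBl mulr_ge0// psd_tr_mul.
  have := psd_diag i (psd_congr Sigma Q1).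
  by rewrite (psd_sym Spsd) mulmxBr mulmxBl mxE [X in _ + X]mxE subr_ge0.
have [[symS _] SS] := psd_sqrtP Spsd; set S := psd_sqrt Sigma in symS SS.
have hpsd : psd (S *m (lam%:M - Sigma) *m S).
  rewrite -{1}symS; apply: psd_congr; split.
    by rewrite linearB/= tr_scalar_mx (psd_sym Spsd).
  move=> u; rewrite mulmxBr mulmxBl mxE [X in _ + X]mxE subr_ge0.
  by rewrite mul_mx_scalar -scalemxAl [leRHS]mxE.
apply: (@le_trans _ _ (lam * \tr (G *m Sigma))); last first.
  by rewrite ler_wpM2r// psd_tr_mul.
have := psd_tr_mul Gpsd hpsd.
have -> : S *m (lam%:M - Sigma) *m S = lam *: Sigma - Sigma *m Sigma.
  rewrite mulmxBr mulmxBl mul_mx_scalar -scalemxAl SS; congr (_ - _).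
  by rewrite -{1}SS !mulmxA SS -mulmxA SS.
rewrite mulmxBr linearB/= -scalemxAr linearZ/= subr_ge0; apply: le_trans.
by rewrite mxtrace_mulC mulmxA mxtrace_mulC.
Qed.

(** Take G = v v^T and Q_i = v v^T on the support of v, and 0 elsewhere. With
    s = v^T Sigma v, the Cauchy-Schwarz inequality on the support bounds the sum
    of the (Sigma v)_i^2 from below by s^2, and the gap is at least
    s (s - rho Card v - tau). *)
Lemma lt_psi_of_form n (Sigma : 'M[R]_n) (rho tau : R) (v : 'cV[R]_n) :
  (0 < n)%N -> psd Sigma -> 0 <= rho -> 0 <= tau -> norm2 v = 1 ->
  tau + rho * (Card v)%:R < (v^T *m Sigma *m v) 0 0 -> tau < psi Sigma rho.
Proof.
move=> n0 Spsd rho0 tau0 v1 h; apply/lt_psi => //.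
have vv : psd (v *m v^T) by have := psd_gram v^T; rewrite trmxK.
exists (v *m v^T), (fun i => (v i 0 != 0)%:R *: (v *m v^T)); split.
  move=> i; case: (v i 0 != 0);
    rewrite ?scale1r ?scale0r ?subrr ?subr0; split=> //; exact: psd0.
set s := (v^T *m Sigma *m v) 0 0 in h *.
have trs : \tr (v *m v^T *m Sigma) = s.
  by rewrite -mulmxA mxtrace_mulC trace_mx11.
rewrite /dual_gap trs.
have entry i : (Sigma *m (v *m v^T) *m Sigma) i i = ((Sigma *m v) i 0) ^+ 2.
  have -> : Sigma *m (v *m v^T) *m Sigma = (Sigma *m v) *m (Sigma *m v)^T.
    by rewrite trmx_mul (psd_sym Spsd) !mulmxA.
  by rewrite mxE big_ord1 [X in _ * X]mxE expr2.
under eq_bigr => i _.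
  rewrite -scalemxAr -!scalemxAl scale_diagE entry mxtraceZ trs.
  rewrite (mulrCA rho) -mulrBr.
  over.
have v2 : \sum_i v i 0 ^+ 2 = 1.
  move/(congr1 (fun x => x ^+ 2)): v1; rewrite /norm2 sqr_sqrtr ?expr1n//.
  by rewrite sumr_ge0// => i _; rewrite sqr_ge0.
have sE : s = \sum_i v i 0 * (Sigma *m v) i 0.
  by rewrite /s -mulmxA mxE; apply: eq_bigr => i _; rewrite mxE.
have cardE : (Card v)%:R = \sum_i (v i 0 != 0)%:R :> R.
  rewrite /Card -sum1_card natr_sum [LHS]big_mkcond/=; apply: eq_bigr => i _.
  by rewrite inE; case: ifP.
(* Cauchy-Schwarz, in the form 2 s x - s^2 <= x^2 summed over the support. *)
have lb : 2 * s * s - s ^+ 2 <= \sum_i (v i 0 != 0)%:R * (Sigma *m v) i 0 ^+ 2.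
  have -> : 2 * s * s - s ^+ 2 = \sum_i
      (2 * s * (v i 0 * (Sigma *m v) i 0) - s ^+ 2 * v i 0 ^+ 2).
    by rewrite sumrB -!mulr_sumr -sE v2 mulr1.
  apply: ler_sum => i _.
  have [->|_] := eqVneq (v i 0) 0.
    by rewrite mul0r mulr0 expr0n/= mulr0 subr0 mul0r.
  rewrite /= mul1r -subr_ge0.
  rewrite (_ : _ - _ = ((Sigma *m v) i 0 - s * v i 0) ^+ 2) ?sqr_ge0//=.
  by ring.
have s0 : 0 < s.
  by apply: le_lt_trans h; rewrite addr_ge0// mulr_ge0.
have -> : \sum_i (v i 0 != 0)%:R * ((Sigma *m v) i 0 ^+ 2 - rho * s) =
  \sum_i (v i 0 != 0)%:R * (Sigma *m v) i 0 ^+ 2 - (Card v)%:R * (rho * s).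
  rewrite cardE mulr_suml -sumrB; apply: eq_bigr => i _; by rewrite mulrBr.
nra.
Qed.
End psi_variational.

(** * Measurability of the rejection region *)

Section measurability.
Context {R : realType}.

Lemma continuous_bigsum (T : topologicalType) (I : Type) (r : seq I)
    (F : I -> T -> R) :
  (forall i, continuous (F i)) -> continuous (fun x => \sum_(i <- r) F i x).
Proof.
move=> cF x; elim: r => [|i r IH].
  under eq_fun do rewrite big_nil; exact: cvg_cst.
under eq_fun do rewrite big_cons.
by apply: cvgD => //; exact: cF.
Qed.

Lemma continuous_sub (T : topologicalType) (f g : T -> R) :
  continuous f -> continuous g -> continuous (fun x => f x - g x).
Proof. by move=> cf cg x; apply: cvgB; [exact: cf|exact: cg]. Qed.

Lemma continuous_mul (T : topologicalType) (f g : T -> R) :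
  continuous f -> continuous g -> continuous (fun x => f x * g x).
Proof. by move=> cf cg x; apply: cvgM; [exact: cf|exact: cg]. Qed.

Lemma continuous_mulmx (T : topologicalType) m n p (F : T -> 'M[R]_(m, n))
    (G : T -> 'M[R]_(n, p)) :
  (forall i j, continuous (fun x => F x i j)) ->
  (forall i j, continuous (fun x => G x i j)) ->
  forall i j, continuous (fun x => (F x *m G x) i j).
Proof.
move=> cF cG i j; under eq_fun do rewrite mxE.
by apply: continuous_bigsum => k; apply: continuous_mul.
Qed.

Lemma continuous_dual_gap n (rho tau : R) (G : 'M[R]_n) Q :
  continuous (fun S : 'M[R]_n => dual_gap S rho tau G Q).
Proof.
have cid i j : continuous (fun S : 'M[R]_n => S i j).
  exact: coord_continuous.
have cc (M : 'M[R]_n) i j : continuous (fun _ : 'M[R]_n => M i j).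
  exact: cst_continuous.
have ctr (M : 'M[R]_n) : continuous (fun S : 'M[R]_n => \tr (M *m S)).
  by rewrite /mxtrace; apply: continuous_bigsum => i; apply: continuous_mulmx.
have ctrZ (a : R) (M : 'M[R]_n) :
    continuous (fun S : 'M[R]_n => a * \tr (M *m S)).
  by apply: continuous_mul => //; exact: cst_continuous.
apply: continuous_sub => //; apply: continuous_bigsum => i.
apply: continuous_sub => //.
by apply: continuous_mulmx => // k l; exact: continuous_mulmx.
Qed.

(** An open set of matrices is a countable union of balls with rational centre
    and radius 1 / (k + 1), and the preimage of such a ball is a finite
    intersection of measurable conditions on the entries. *)
Lemma measurable_preimage_open_mx d (T : measurableType d) n
    (f : T -> 'M[R]_n) (O : set 'M[R]_n) :
  (forall i j, measurable_fun setT (fun w => f w i j)) -> open O ->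
  measurable (f @^-1` O).
Proof.
move=> mf oO; pose e (k : nat) : R := k.+1%:R^-1.
pose B (p : 'M[rat]_n * nat) : set T :=
  \bigcap_(ij in [set: 'I_n * 'I_n])
    [set w | `|ratr (p.1 ij.1 ij.2) - f w ij.1 ij.2| < e p.2].
pose C (p : 'M[rat]_n * nat) : Prop :=
  ball (map_mx ratr p.1 : 'M[R]_n) (e p.2) `<=` O.
have -> : f @^-1` O = \bigcup_p (if `[< C p >] then B p else set0).
  apply/seteqP; split=> [w /= Ow|w [p _]].
    have /nbhs_ballP[r r0 rO] := open_nbhs_nbhs (conj oO Ow).
    have [k kr] : exists k, e k < r / 2.
      have r20 : 0 < r / 2 by rewrite divr_gt0.
      exists (Num.truncn (r / 2)^-1); rewrite /e invf_plt ?posrE//.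
      exact: truncnS_gt.
    have ek0 : 0 < e k by rewrite invr_gt0.
    have hq (ij : 'I_n * 'I_n) :
        exists q : rat, `|ratr q - f w ij.1 ij.2| < e k.
      have [|q] := @rat_in_itvoo R (f w ij.1 ij.2 - e k) (f w ij.1 ij.2 + e k).
        by rewrite ltrD2l gtrN.
      rewrite in_itv/= => /andP[q1 q2]; exists q.
      by rewrite ltr_norml; apply/andP; split; lra.
    have [q qP] := choice hq.
    pose qm : 'M[rat]_n := \matrix_(i, j) q (i, j).
    exists (qm, k) => //; case: asboolP => [_ [i j] _ /=|].
      by rewrite mxE; exact: (qP (i, j)).
    case=> M [_ /= hM]; apply: rO; split=> // i j.
    have := qP (i, j); have := hM i j; rewrite /ball/= !mxE => h1 h2.
    have := ler_normD (f w i j - ratr (q (i, j))) (ratr (q (i, j)) - M i j).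
    rewrite addrA subrK => /le_lt_trans; apply.
    rewrite distrC; lra.
  case: asboolP => // Cp Bp; apply: Cp; split; first by rewrite invr_gt0.
  by move=> i j; have := Bp (i, j) Logic.I; rewrite /ball/= mxE.
apply: countable_bigcupT_measurable; first exact: countableP.
move=> p; case: asboolP => // _.
apply: fin_bigcap_measurable; first exact: finite_finset.
move=> ij _; rewrite -[X in measurable X]setTI.
have mg : measurable_fun setT
    (fun w => `|ratr (p.1 ij.1 ij.2) - f w ij.1 ij.2|).
  apply: measurableT_comp => //; apply: measurable_funB => //.
have := mg measurableT `]-oo, (e p.2)[%classic (measurable_itv _).
by congr (measurable (_ `&` _)); apply/seteqP; split => w; rewrite /= in_itv.
Qed.

Lemma measurable_lt_psi d (T : measurableType d) n (f : T -> 'M[R]_n)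
    (rho tau : R) : (0 < n)%N -> 0 <= rho -> 0 <= tau ->
  (forall w, psd (f w)) ->
  (forall i j, measurable_fun setT (fun w => f w i j)) ->
  measurable [set w | tau < psi (f w) rho].
Proof.
move=> n0 rho0 tau0 fpsd mf.
pose O := \bigcup_(p in [set p : 'M[R]_n * ('I_n -> 'M[R]_n) |
    forall i, psd (p.2 i) /\ psd (p.1 - p.2 i)])
  [set S : 'M[R]_n | 0 < dual_gap S rho tau p.1 p.2].
rewrite (_ : [set _ | _] = f @^-1` O).
  apply: measurable_preimage_open_mx => //; apply: bigcup_open => p _.
  apply: (@open_comp _ _ (fun S => dual_gap S rho tau p.1 p.2)
    [set x : R | 0 < x]).
    by move=> S _; exact: continuous_dual_gap.
  exact: open_gt.
apply/seteqP; split => w /=.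
  move=> /(lt_psi n0 (fpsd w) rho0 tau0) [G [Q [hQ gap]]].
  by exists (G, Q).
move=> [[G Q] /= hQ gap]; apply/lt_psi => //; by exists G, Q.
Qed.
End measurability.

(** * A net of the sphere controlling quadratic forms *)

Section net.
Context {R : realType}.
Implicit Types n : nat.

(** Integer vectors coded by a sign and an absolute value at most 4 n, a range
    that contains the integer parts of the coordinates of 4 sqrt n times a unit
    vector. *)
Definition grid n := {ffun 'I_n -> bool * 'I_(4 * n).+1}.

Definition grid_vec n (z : grid n) : 'cV[R]_n :=
  \col_i ((-1) ^+ (z i).1 * ((z i).2 : nat)%:R).

(** The vectors of the grid with norm at most 4 sqrt n. Divided by 4 sqrt n,
    they lie in the unit ball and approximate each unit vector within distance
    1/4 ([net_approx]). *)
Definition net n : {set grid n} :=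
  [set z : grid n | (\sum_i (z i).2 ^ 2 <= 16 * n)%N].

Lemma sum_half_powers N : \sum_(k < N) (2^-1 : R) ^+ k <= 2.
Proof.
have -> : \sum_(k < N) (2^-1 : R) ^+ k = 2 - 2 * 2^-1 ^+ N.
  elim: N => [|N IH]; first by rewrite big_ord0 expr0; lra.
  by rewrite big_ord_recr/= IH exprS; lra.
by rewrite gerBl mulr_ge0// exprn_ge0.
Qed.

(** A Chernoff argument for counting: every z in the net satisfies
    sum |z_i| <= sum z_i^2 <= 16 n, so that its weight prod 2^(-|z_i|) is at
    least 2^(-16 n), while the total weight of the grid is at most 4^n. *)
Lemma card_net n : (#|net n|%:R : R) <= (2 ^+ 18) ^+ n.
Proof.
pose wt (j : bool * 'I_(4 * n).+1) : R := 2^-1 ^+ j.2.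
have wt0 j : 0 <= wt j by rewrite exprn_ge0.
have wts : \sum_j wt j <= 4.
  rewrite -(pair_big predT predT (fun b k => wt (b, k)))/=.
  rewrite big_bool/= /wt/=.
  by have := sum_half_powers (4 * n).+1; lra.
rewrite -sum1_card natr_sum.
apply: (@le_trans _ _ (\sum_(z in net n) 2 ^+ (16 * n) * \prod_i wt (z i))).
  apply: ler_sum => z; rewrite inE => zn.
  rewrite /wt prodrXr exprVn ler_pdivlMr ?exprn_gt0// mul1r.
  rewrite ler_weXn2l ?ler1n//; apply: leq_trans zn; apply: leq_sum => i _.
  by case: (nat_of_ord _) => // k; rewrite leq_pmulr.
rewrite -mulr_sumr.
apply: (@le_trans _ _ (2 ^+ (16 * n) * \sum_(z : grid n) \prod_i wt (z i))).
  rewrite ler_wpM2l ?exprn_ge0// [leLHS]big_mkcond/= ler_sum// => z _.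
  by case: ifP => // _; exact: prodr_ge0.
rewrite -(bigA_distr_bigA (fun _ j => wt j)) prodr_const card_ord.
apply: (@le_trans _ _ (2 ^+ (16 * n) * 4 ^+ n)).
  by rewrite ler_wpM2l ?exprn_ge0// lerXn2r// nnegrE// sumr_ge0.
rewrite exprM -exprMn lerXn2r ?nnegrE ?mulr_ge0 ?exprn_ge0//.
by rewrite (exprD _ 16 2) ler_wpM2l ?exprn_ge0//; lra.
Qed.

Lemma quad_bound n (W : 'M[R]_n) (u : 'cV[R]_n) : (u^T *m u) 0 0 = 1 ->
  `|(u^T *m W *m u) 0 0| <= \sum_i \sum_j `|W i j|.
Proof.
move=> u1.
have ule i : `|u i 0| <= 1.
  rewrite -(ler_pXn2r (n := 2)) ?nnegrE// expr1n real_normK ?num_real// -u1.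
  rewrite mxE (bigD1 i)//= mxE -expr2 lerDl sumr_ge0// => j _.
  by rewrite mxE -expr2 sqr_ge0.
rewrite -mulmxA mxE; apply: (le_trans (ler_norm_sum _ _ _)).
apply: ler_sum => i _; rewrite mxE normrM.
apply: (@le_trans _ _ (1 * `|(W *m u) i 0|)); first by rewrite ler_wpM2r.
rewrite mul1r mxE; apply: (le_trans (ler_norm_sum _ _ _)).
by apply: ler_sum => j _; rewrite normrM ler_piMr.
Qed.

Lemma mx11D (a b : 'M[R]_1) : (a + b) 0 0 = a 0 0 + b 0 0.
Proof. by rewrite mxE. Qed.

Lemma mx11N (a : 'M[R]_1) : (- a) 0 0 = - a 0 0.
Proof. by rewrite mxE. Qed.

Lemma parallelogram n (x y : 'cV[R]_n) :
  ((x + y)^T *m (x + y)) 0 0 + ((x - y)^T *m (x - y)) 0 0 =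
  2 * ((x^T *m x) 0 0 + (y^T *m y) 0 0).
Proof.
rewrite !mxE -!big_split/= mulr_sumr; apply: eq_bigr => i _.
by rewrite !mxE; ring.
Qed.

(** Polarisation: 4 a^T W b is the difference of the form at a + b and a - b. *)
Lemma polar_bound n (W : 'M[R]_n) (om : R) (a b : 'cV[R]_n) : W^T = W ->
  (forall u : 'cV[R]_n, `|(u^T *m W *m u) 0 0| <= om * (u^T *m u) 0 0) ->
  2 * `|(a^T *m W *m b) 0 0| <= om * ((a^T *m a) 0 0 + (b^T *m b) 0 0).
Proof.
move=> symW hom.
pose q (x y : 'cV[R]_n) := (x^T *m W *m y) 0 0.
pose d (x y : 'cV[R]_n) := (x^T *m y) 0 0.
have qC x y : q x y = q y x.
  have := congr1 (fun M : 'M[R]_1 => M 0 0) (trmx_mul (x^T *m W) y).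
  by rewrite mxE trmx_mul trmxK symW mulmxA.
have qD x y : q (x + y) (x + y) = q x x + 2 * q x y + q y y.
  have T : (x + y)^T = x^T + y^T by rewrite linearD.
  by rewrite {1}/q T !mulmxDl !mulmxDr !(mx11D, mx11N)
       -/(q x x) -/(q x y) -/(q y x) -/(q y y) (qC y x); lra.
have qB x y : q (x - y) (x - y) = q x x - 2 * q x y + q y y.
  have T : (x - y)^T = x^T - y^T by rewrite linearB.
  by rewrite {1}/q T !mulmxBl !mulmxBr !(mx11D, mx11N)
       -/(q x x) -/(q x y) -/(q y x) -/(q y y) (qC y x); lra.
have dD x y : d (x + y) (x + y) + d (x - y) (x - y) = 2 * (d x x + d y y).
  exact: parallelogram.
have : `|q (a + b) (a + b)| <= om * d (a + b) (a + b) := hom _.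
have : `|q (a - b) (a - b)| <= om * d (a - b) (a - b) := hom _.
rewrite -/(q a b) -/(d a a) -/(d b b) qB qD !ler_norml.
move=> /andP[h1 h2] /andP[h3 h4].
have := dD a b => hd.
have E : om * (d (a + b) (a + b)) + om * d (a - b) (a - b) =
    2 * (om * (d a a + d b b)).
  by rewrite -mulrDr hd; ring.
rewrite -ler_pdivlMl// ler_norml; apply/andP; split; lra.
Qed.

(** Truncating the coordinates of 4 sqrt n u towards 0 moves each of them by at
    most 1 and does not increase the norm. *)
Lemma net_approx n (u : 'cV[R]_n) : (0 < n)%N -> (u^T *m u) 0 0 = 1 ->
  exists2 z, z \in net n & let y := (4 * Num.sqrt n%:R)^-1 *: grid_vec z in
    16 * ((u - y)^T *m (u - y)) 0 0 <= 1 /\ (y^T *m y) 0 0 <= 1.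
Proof.
move=> n0 u1; pose c : R := 4 * Num.sqrt n%:R.
have sqE (x : 'cV[R]_n) : (x^T *m x) 0 0 = \sum_i x i 0 ^+ 2.
  by rewrite mxE; apply: eq_bigr => i _; rewrite mxE expr2.
have nR : (0 : R) < n%:R by rewrite ltr0n.
have c0 : 0 < c by rewrite mulr_gt0// sqrtr_gt0.
have c2 : c ^+ 2 = 16 * n%:R by rewrite exprMn sqr_sqrtr ?ler0n//; ring.
have ule i : `|u i 0| <= 1.
  rewrite -(ler_pXn2r (n := 2)) ?nnegrE// expr1n real_normK ?num_real// -u1 sqE.
  by rewrite (bigD1 i)//= lerDl sumr_ge0// => j _; rewrite sqr_ge0.
pose k i := Num.truncn (c * `|u i 0|).
have cu0 i : 0 <= c * `|u i 0| by rewrite mulr_ge0// ltW.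
have kle i : (k i)%:R <= c * `|u i 0| by rewrite truncn_le.
have ltk i : c * `|u i 0| < (k i).+1%:R by exact: truncnS_gt.
have kn i : (k i < (4 * n).+1)%N.
  rewrite ltnS -(ler_nat R); apply: (le_trans (kle i)).
  apply: (@le_trans _ _ (c * 1)); first by rewrite ler_wpM2l// ltW.
  rewrite mulr1 natrM ler_wpM2l// -(ler_pXn2r (n := 2)) ?nnegrE ?sqrtr_ge0//.
  by rewrite sqr_sqrtr// -natrX ler_nat leq_pmulr.
pose z : grid n := [ffun i => (u i 0 < 0, Ordinal (kn i))].
have z2 i : ((z i).2 : nat) = k i by rewrite ffunE.
have kc i : ((k i)%:R / c) <= `|u i 0| by rewrite ler_pdivrMr// mulrC.
have kc0 i : 0 <= ((k i)%:R / c) by rewrite divr_ge0// ltW.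
have kcS i : `|u i 0| <= (k i)%:R / c + c^-1.
  rewrite -[X in _ + X]div1r -mulrDl ler_pdivlMr// mulrC.
  by rewrite -[1]/(1%:R) -natrD addn1 ltW.
have yE i : (c^-1 *: grid_vec z) i 0 = (-1) ^+ (u i 0 < 0)%R * ((k i)%:R / c).
  by rewrite !mxE ffunE/=; ring.
exists z; last first.
  rewrite -/c; split; rewrite sqE; last first.
    rewrite -[leRHS]u1 sqE ler_sum// => i _; rewrite yE exprMn sqrr_sign mul1r.
    by rewrite -[leRHS]real_normK ?num_real// lerXn2r ?nnegrE.
  have oneE : 1 = 16 * \sum_(i < n) c^-1 ^+ 2.
    by rewrite sumr_const card_ord exprVn c2 -mulr_natr; field; rewrite gt_eqF.
  rewrite [leRHS]oneE ler_pM2l// ler_sum// => i _.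
  rewrite mxE [X in _ + X]mxE yE.
  rewrite {1}[u i 0]numEsign -mulrBr exprMn sqrr_sign mul1r.
  rewrite lerXn2r ?nnegrE ?invr_ge0 ?subr_ge0 ?(ltW c0)//.
  by rewrite lerBlDl.
rewrite inE -(ler_nat R) natr_sum natrM -c2 -[leRHS]mulr1.
rewrite -[X in _ <= _ * X]u1 sqE mulr_sumr.
apply: ler_sum => i _; rewrite z2 natrX -exprMn.
rewrite -[leRHS]real_normK ?num_real// lerXn2r ?nnegrE//.
by rewrite normrM gtr0_norm.
Qed.

(** Let om be the supremum of the form on the sphere. Replacing u by a net point
    y changes the form by (u - y)^T W (u + y), which is at most (2/3) om
    because |u - y| <= 1/4 and |u + y| <= 2. Hence om <= s + (2/3) om. *)
Lemma net_form n (W : 'M[R]_n) (s : R) : (0 < n)%N -> W^T = W -> 0 <= s ->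
  (forall z, z \in net n -> `|((grid_vec z)^T *m W *m grid_vec z) 0 0| <=
     s * ((grid_vec z)^T *m grid_vec z) 0 0) ->
  forall u : 'cV[R]_n, `|(u^T *m W *m u) 0 0| <= 3 * s * (u^T *m u) 0 0.
Proof.
move=> n0 symW s0 hnet.
pose q (x y : 'cV[R]_n) := (x^T *m W *m y) 0 0.
pose d (x : 'cV[R]_n) := (x^T *m x) 0 0.
have qZ a b x y : q (a *: x) (b *: y) = a * b * q x y.
  rewrite /q (_ : (a *: x)^T = a *: x^T); last by rewrite linearZ.
  by rewrite -!scalemxAl -scalemxAr scalerA mxE.
have dZ a x : d (a *: x) = a ^+ 2 * d x.
  rewrite /d (_ : (a *: x)^T = a *: x^T); last by rewrite linearZ.
  by rewrite -!scalemxAl -scalemxAr scalerA mxE.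
pose E := [set `|q u u| | u in [set u | d u = 1]].
have E0 : E !=set0.
  pose e1 : 'cV[R]_n := delta_mx (Ordinal n0) 0.
  exists `|q e1 e1|, e1 => //=.
  by rewrite /d trmx_delta mul_delta_mx mxE !eqxx.
have hE : has_ubound E.
  by exists (\sum_i \sum_j `|W i j|) => _ [u u1 <-]; exact: quad_bound.
pose om := sup E.
have unit_om (om' : R) : (forall u, d u = 1 -> `|q u u| <= om') ->
    forall u, `|q u u| <= om' * d u.
  move=> h u; have := sumsqr_ge0 u; rewrite -/(d u) le0r => /orP[/eqP du|du].
    by rewrite /q du mulr0 (sumsqr_eq0 du) mulmx0 mxE normr0.
  have sq0 : 0 < Num.sqrt (d u) by rewrite sqrtr_gt0.
  have := h ((Num.sqrt (d u))^-1 *: u).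
  rewrite dZ qZ -expr2 exprVn sqr_sqrtr ?(ltW du)// mulVf ?gt_eqF//.
  move=> /(_ erefl).
  by rewrite normrM gtr0_norm ?invr_gt0// mulrC ler_pdivrMr.
have hom : forall u, `|q u u| <= om * d u.
  by apply: unit_om => u u1; apply: ub_le_sup => //; exists u.
have om0 : 0 <= om.
  have [_ [u u1 _]] := E0; apply: le_trans (normr_ge0 (q u u)) _.
  by apply: ub_le_sup => //; exists u.
suff oms : om <= 3 * s.
  move=> u; apply: (le_trans (hom u)).
  by rewrite ler_wpM2r// sumsqr_ge0.
suff : om <= s + 2 / 3 * om by lra.
apply: ge_sup => // _ [u u1 <-].
have [z zn [uy y1]] := net_approx n0 u1.
set y := _ *: _ in uy y1; rewrite -/(d _) in uy; rewrite -/(d _) in y1.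
have qy : `|q y y| <= s.
  rewrite /y qZ normrM -expr2 ger0_norm ?sqr_ge0//.
  apply: (@le_trans _ _ (s * d y)); last by rewrite -[leRHS]mulr1 ler_wpM2l.
  rewrite /y dZ mulrCA ler_wpM2l ?sqr_ge0//; exact: hnet.
have qC x x' : q x x' = q x' x.
  have := congr1 (fun M : 'M[R]_1 => M 0 0) (trmx_mul (x^T *m W) x').
  by rewrite mxE trmx_mul trmxK symW mulmxA.
have quE : q u u = q y y + q (u - y) (u + y).
  have T : (u - y)^T = u^T - y^T by rewrite linearB.
  by rewrite {3}/q T !mulmxBl !mulmxDr !(mx11D, mx11N)
       -/(q u u) -/(q u y) -/(q y u) -/(q y y) (qC y u); lra.
(* The factors 3 and 1/3 nearly balance the norms of u - y and u + y, at most
   1/4 and 2. *)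
have : 2 * `|q (3 *: (u - y)) (3^-1 *: (u + y))| <=
    om * (d (3 *: (u - y)) + d (3^-1 *: (u + y))) := polar_bound _ _ symW hom.
rewrite qZ !dZ divff ?pnatr_eq0// mul1r => hq.
have par : d (u + y) + d (u - y) = 2 * (d u + d y) := parallelogram u y.
rewrite u1 in par.
have duy0 : 0 <= d (u - y) by exact: sumsqr_ge0.
have bnd : 3 ^+ 2 * d (u - y) + 3^-1 ^+ 2 * d (u + y) <= 4 / 3 by lra.
have := ler_wpM2l om0 bnd => hb.
rewrite quE; apply: (le_trans (ler_normD _ _)); lra.
Qed.
End net.

(** * Integration against an image of a density *)

Section integration.
Context {R : realType}.
Import HBNNSimple.
Local Open Scope ereal_scope.

(** The image by X of the measure with density F. The case X = id gives the
    integral against a measure with a density; the case where nu is a multiple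
    of the law of X is the factorisation of an expectation, with F the product
    of the other factors. *)
Lemma ge0_integral_density_map d d' (T : measurableType d)
    (T' : measurableType d') (mu : {measure set T -> \bar R})
    (nu : {measure set T' -> \bar R}) (X : T -> T') (F : T -> R) :
  measurable_fun setT X -> measurable_fun setT F -> (forall w, (0 <= F w)%R) ->
  (forall B, measurable B -> nu B = \int[mu]_(w in X @^-1` B) (F w)%:E) ->
  forall g : T' -> \bar R, measurable_fun setT g -> (forall y, 0 <= g y) ->
  \int[nu]_y g y = \int[mu]_w (g (X w) * (F w)%:E).
Proof.
move=> mX mF F0 nuE g mg g0.
pose f_ := nnsfun_approx measurableT mg.
have f_cvg y : (f_ n y)%:E @[n --> \oo] --> g y by exact: cvg_nnsfun_approx.
have f_nd y : nondecreasing_seq (fun n => (f_ n y)%:E).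
  by move=> k l kl; rewrite lee_fin; exact/lefP/nd_nnsfun_approx.
transitivity (limn (fun n => \int[nu]_y (f_ n y)%:E)).
  rewrite -monotone_convergence//.
  - by apply: eq_integral => y _; apply/esym/cvg_lim.
  - by move=> n; exact/measurable_EFinP/measurable_funP.
  - by move=> n y _; rewrite lee_fin.
have mf_X n : measurable_fun setT (fun w => f_ n (X w)).
  exact: measurableT_comp.
transitivity (limn (fun n => \int[mu]_w ((f_ n (X w))%:E * (F w)%:E)));
  last first.
  rewrite -monotone_convergence//.
  - apply: eq_integral => w _; apply/cvg_lim => //.
    by apply: cvgeZr => //; exact: f_cvg.
  - by move=> n; apply/measurable_EFinP; exact: measurable_funM.
  - by move=> n w _; rewrite mule_ge0 ?lee_fin.
  - by move=> w _ k l kl; rewrite lee_wpmul2r ?lee_fin//; exact: f_nd.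
congr (limn _); apply/funext => n.
have mfn r : measurable (f_ n @^-1` [set r]) by exact: measurable_funPTI.
transitivity (\sum_(k \in range (f_ n))
    \int[mu]_w ((k * \1_(f_ n @^-1` [set k]) (X w) * F w)%:E)).
  under eq_integral do rewrite fimfunE -fsumEFin//.
  rewrite ge0_integral_fsum//; last 2 first.
  - by move=> y; exact/measurable_EFinP/measurable_funM.
  - by move=> y x _; rewrite nnfun_muleindic_ge0.
  apply: eq_fsbigr => r; rewrite inE => -[y _ <-].
  rewrite integralZl_indic_nnsfun// integral_indic// setIT nuE//.
  have mB : measurable (X @^-1` (f_ n @^-1` [set f_ n y])).
    by rewrite -[X in measurable X]setTI; exact: mX.
  rewrite integral_mkcond epatch_indic -ge0_integralZl//; last 3 first.
  - apply: emeasurable_funM; first exact/measurable_EFinP.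
    exact/measurable_EFinP/measurable_indic.
  - by move=> w _ /=; rewrite -EFinM lee_fin mulr_ge0.
  - by rewrite lee_fin.
  apply: eq_integral => w _ /=; rewrite -!EFinM; congr EFin.
  by rewrite -mulrA; congr (_ * _)%R; rewrite mulrC.
rewrite -ge0_integral_fsum//; last 2 first.
- move=> r; apply/measurable_EFinP/measurable_funM => //.
  apply: measurable_funM => //; apply: (measurableT_comp _ mX).
  exact: measurable_indic.
- move=> r w _; rewrite lee_fin mulr_ge0//.
  by have := nnfun_muleindic_ge0 (f_ n) r (X w); rewrite lee_fin.
apply: eq_integral => w _; rewrite -EFinM [f_ n (X w)]fimfunE.
by rewrite mulr_fsuml fsumEFin.
Qed.
End integration.

(** * Expectation of a product of independent factors *)

Section independence.
Context {R : realType} d (T : measurableType d) (P : probability T R).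
Context (m n : nat) (x : 'I_m -> {RV P >-> n.-tuple R}).
Context (indep : mutually_independent x).
Local Open Scope ereal_scope.

(** Replace indicator functions by general functions one coordinate at a time.
    At each step the products of the other factors, seen as a density F,
    give to the law of x_j a constant multiple of itself. *)
Lemma independent_prod (g : 'I_m -> n.-tuple R -> R) (c : 'I_m -> R) :
  (forall i, measurable_fun setT (g i)) -> (forall i t, (0 <= g i t)%R) ->
  (forall i, \int[P]_w (g i (x i w))%:E = (c i)%:E) ->
  \int[P]_w (\prod_i g i (x i w))%R%:E = (\prod_i c i)%R%:E.
Proof.
move=> mg g0 gc.
have mx i : measurable_fun setT (x i) by exact: measurable_funP.
(* Only the first k functions are arbitrary; the others are indicators. *)
suff main k : forall (g : 'I_m -> n.-tuple R -> R) (c : 'I_m -> R),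
    (forall i, measurable_fun setT (g i)) -> (forall i t, (0 <= g i t)%R) ->
    (forall i, \int[P]_w (g i (x i w))%:E = (c i)%:E) ->
    (forall i : 'I_m, (k <= i)%N ->
      exists2 B, measurable B & g i = \1_B :> (_ -> R)) ->
    \int[P]_w (\prod_i g i (x i w))%R%:E = (\prod_i c i)%R%:E.
  by apply: (main m) => // i; rewrite leqNgt ltn_ord.
elim: k => [|k IH] {mg g0 gc}g {}c mg g0 gc hind.
  have hB i : exists B, measurable B /\ g i = \1_B :> (_ -> R).
    by have [//|B mB gB] := hind i _; exists B.
  have [B hB'] := choice hB.
  have mB i : measurable (x i @^-1` B i).
    rewrite -[X in measurable X]setTI; apply: mx => //; exact: (hB' i).1.
  have cE i : (c i)%:E = P (x i @^-1` B i).
    rewrite -gc (hB' i).2 -[X in _ = P X]setIT -integral_indic//.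
  have -> : (\prod_i c i)%R%:E = \prod_i P (x i @^-1` B i).
    by rewrite -prodEFin; apply: eq_bigr => i _.
  rewrite -indep; last by move=> i; exact: (hB' i).1.
  rewrite -[X in _ = P X]setIT -integral_indic//; last first.
    exact: fin_bigcap_measurable.
  apply: eq_integral => w _; congr EFin.
  transitivity (\prod_i (\1_(x i @^-1` B i) w : R))%R.
    by apply: eq_bigr => i _; rewrite (hB' i).2.
  rewrite [RHS]indicE; case: (boolP (w \in _)) => [/set_mem wB|/negP wB].
    by rewrite big1// => i _; rewrite indicE mem_set//; exact: wB.
  have [i wi] : exists i, ~ (x i @^-1` B i) w.
    by apply/existsNP => h; apply: wB; apply/mem_set => i _; exact: h.
  by rewrite (bigD1 i)//= indicE memNset// mul0r.
have [km|mk] := ltnP k m; last first.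
  by apply: IH => // i ki; have := ltn_ord i; rewrite ltnNge (leq_trans mk ki).
pose j := Ordinal km.
pose F w : R := (\prod_(i | i != j) g i (x i w))%R.
pose C : R := (\prod_(i | i != j) c i)%R.
have mgx i : measurable_fun setT (fun w => g i (x i w)).
  exact: measurableT_comp.
have mF : measurable_fun setT F.
  rewrite /F; under eq_fun do rewrite -big_filter.
  by apply: measurable_prod => i _; exact: mgx.
have F0 w : (0 <= F w)%R by exact: prodr_ge0.
have c0 i : (0 <= c i)%R.
  by rewrite -lee_fin -gc integral_ge0// => w _; rewrite lee_fin.
have C0 : (0 <= C)%R by exact: prodr_ge0.
pose nu := mscale (NngNum C0) (distribution P (x j)).
have key B : measurable B -> nu B = \int[P]_(w in x j @^-1` B) (F w)%:E.
  move=> mB.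
  have mxB : measurable (x j @^-1` B).
    by rewrite -[X in measurable X]setTI; exact: mx.
  pose g' i := if i == j then \1_B : _ -> R else g i.
  pose c' i := if i == j then fine (P (x j @^-1` B)) else c i.
  have := IH g' c'; rewrite /g' /c'.
  move=> /(_ _ _ _ _) h.
  transitivity (\prod_i c' i)%R%:E.
    rewrite (bigD1 j)//= /c' eqxx EFinM fineK ?fin_num_measure//.
    rewrite muleC; congr (_ * _); congr EFin.
    by apply: eq_bigr => i /negbTE ->.
  rewrite -h.
  - rewrite [RHS]integral_mkcond epatch_indic; apply: eq_integral => w _ /=.
    rewrite -EFinM; congr EFin; rewrite (bigD1 j)//= eqxx mulrC.
    congr (_ * _)%R.
    by apply: eq_bigr => i /negbTE ->.
  - move=> i; case: ifP => // _; exact: measurable_indic.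
  - by move=> i t; case: ifP => // _; rewrite indicE.
  - move=> i; case: eqVneq => [->|_] //.
    by rewrite fineK ?fin_num_measure// -[X in _ = P X]setIT -integral_indic.
  - move=> i ki; case: eqVneq => [_|ij]; first by exists B.
    by apply: hind; rewrite ltn_neqAle ki andbT eq_sym.
have mgE : measurable_fun setT (EFin \o g j) by exact/measurable_EFinP.
have := ge0_integral_density_map (mx j) mF F0 key mgE.
move=> /(_ (fun t => g0 j t)) h.
transitivity (\int[P]_w ((EFin \o g j) (x j w) * (F w)%:E)).
  apply: eq_integral => w _.
  by rewrite /= -EFinM (bigD1 j).
rewrite -h /nu ge0_integral_mscale//; last by move=> t _; rewrite lee_fin.
rewrite ge0_integral_pushforward//; last by move=> t _; rewrite lee_fin.
by rewrite preimage_setT /= gc -EFinM [in RHS](bigD1 j)//= mulrC.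
Qed.
End independence.

(** * Exponential bounds and the Laplace transform of a squared normal *)

Section exp_bounds.
Context {R : realType}.

(** The function (1 + y) exp (y^2/2 - y) has derivative y^2 exp (y^2/2 - y) >= 0
    and value 1 at 0. The quadratic term is what makes the lower tail of the
    chi-square law sharp. *)
Lemma expR_quad_le1D (x : R) : 0 <= x -> expR (x - x ^+ 2 / 2) <= 1 + x.
Proof.
move=> x0; pose f (y : R) : R := (1 + y) * expR (y ^+ 2 / 2 - y).
pose df (y : R) : R := y ^+ 2 * expR (y ^+ 2 / 2 - y).
have fdf (y : R) : is_derive y (1 : R) f (df y).
  have h : is_derive y (1 : R) (fun y : R => y ^+ 2 / 2 - y) (y - 1).
    apply: is_derive_eq.
    by rewrite /GRing.scale/=; field.
  have h2 : is_derive y (1 : R) (expR \o (fun y : R => y ^+ 2 / 2 - y))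
      (expR (y ^+ 2 / 2 - y) * (y - 1)).
    exact: is_derive1_comp (is_derive_expR _) h.
  have h1 : is_derive y (1 : R) (fun y : R => 1 + y) 1.
    by apply: is_derive_eq; rewrite add0r mulr1.
  have h3 := is_deriveM h1 h2.
  by apply: (is_derive_eq h3); rewrite /df /GRing.scale/=; ring.
have [|c _] := @MVT_segment R f df 0 x x0 (fun y _ => fdf y).
  by apply: derivable_within_continuous => y _; have [] := fdf y.
rewrite /f /df => hc.
have fx : 1 <= (1 + x) * expR (x ^+ 2 / 2 - x).
  rewrite -[X in X <= _](_ : (1 + 0) * expR (0 ^+ 2 / 2 - 0) = 1).
    rewrite -subr_ge0 hc subr0 mulr_ge0// mulr_ge0 ?expR_ge0 ?sqr_ge0//.
  by rewrite expr0n/= mul0r subrr expR0 addr0 mulr1.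
have -> : x - x ^+ 2 / 2 = - (x ^+ 2 / 2 - x) by ring.
by rewrite expRN -[X in X <= _]mul1r ler_pdivrMr ?expR_gt0.
Qed.

(** Follows from exp z >= 1 + z with z = x + 2 x^2, since
    (1 - x) (1 + z) = 1 + x^2 (1 - 2 x). *)
Lemma inv1B_le_expR (x : R) :
  `|x| <= 1 / 2 -> 1 <= (1 - x) * expR (x + 2 * x ^+ 2).
Proof.
rewrite ler_norml => /andP[x1 x2].
apply: (@le_trans _ _ ((1 - x) * (1 + (x + 2 * x ^+ 2)))); last first.
  by rewrite ler_wpM2l ?expR_ge1Dx//; lra.
have -> : (1 - x) * (1 + (x + 2 * x ^+ 2)) = 1 + x ^+ 2 * (1 - 2 * x) by ring.
by rewrite lerDl mulr_ge0 ?sqr_ge0//; lra.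
Qed.

Lemma powV_sqrt_expR (a b : R) (m : nat) : 0 < a -> expR (2 * b) <= a ->
  (Num.sqrt a)^-1 ^+ m <= expR (- (m%:R * b)).
Proof.
move=> a0 ba; rewrite -mulrN expRM_natl.
rewrite lerXn2r ?nnegrE ?expR_ge0 ?invr_ge0 ?sqrtr_ge0//.
rewrite expRN lef_pV2 ?posrE ?sqrtr_gt0 ?expR_gt0//.
rewrite -(ler_pXn2r (n := 2)) ?nnegrE ?expR_ge0 ?sqrtr_ge0//.
by rewrite sqr_sqrtr ?(ltW a0)// -expRM_natl.
Qed.
End exp_bounds.

Section normal_mgf.
Context {R : realType}.
Local Notation leb := (@lebesgue_measure R).

Lemma ge0_integral_normal_prob (s : R) (g : R -> R) :
  measurable_fun setT g -> (forall y, 0 <= g y) ->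
  (\int[normal_prob 0 s]_y (g y)%:E =
   \int[leb]_y (g y * normal_pdf 0 s y)%:E)%E.
Proof.
move=> mg g0.
have := @ge0_integral_density_map R _ _ _ _ leb (normal_prob 0 s) id
  (normal_pdf 0 s) (@measurable_id _ _ _) (measurable_normal_pdf 0 s)
  (normal_pdf_ge0 0 s) (fun B _ => erefl) (EFin \o g).
by rewrite /= => ->//; exact/measurable_EFinP.
Qed.

(** Both sides are Gaussian functions of y: the exponents agree because
    1 / s^2 - 2 lam = r^2 / s^2. *)
Lemma normal_pdf_tilt (s r lam y : R) : 0 < s -> 0 < r ->
  r ^+ 2 = 1 - 2 * lam * s ^+ 2 ->
  expR (lam * y ^+ 2) * normal_pdf 0 s y = r^-1 * normal_pdf 0 (s / r) y.
Proof.
move=> s0 r0 r2.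
have peakE (t : R) : 0 < t -> normal_peak t = t^-1 * (Num.sqrt (pi *+ 2))^-1.
  move=> t0; rewrite /normal_peak -mulrnAr sqrtrM ?sqr_ge0//.
  by rewrite sqrtr_sqr gtr0_norm// invfM.
have sr0 : 0 < s / r by rewrite divr_gt0.
rewrite !normal_pdfE ?gt_eqF// !peakE// /normal_fun !subr0.
have -> : - y ^+ 2 / ((s / r) ^+ 2 *+ 2) =
    lam * y ^+ 2 + - y ^+ 2 / (s ^+ 2 *+ 2).
  have -> : ((s / r) ^+ 2 *+ 2)^-1 = r ^+ 2 * (s ^+ 2 *+ 2)^-1.
    by rewrite expr_div_n -mulrnAl invfM invrK mulrC.
  have h : s ^+ 2 * (s ^+ 2 *+ 2)^-1 = 2^-1.
    by rewrite -[s ^+ 2 *+ 2]mulr_natr invfM mulVKf// expf_neq0// gt_eqF.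
  move: ((s ^+ 2 *+ 2)^-1) h => i h; rewrite r2.
  have -> : - y ^+ 2 * ((1 - 2 * lam * s ^+ 2) * i) =
      - y ^+ 2 * i + 2 * lam * y ^+ 2 * (s ^+ 2 * i) by ring.
  by rewrite h; field.
rewrite expRD invfM invrK.
move: (expR (lam * _)) (expR (- _ / _)) (Num.sqrt _)^-1 (s^-1) => a b p t.
rewrite [RHS]mulrA [r^-1 * _]mulrA [r^-1 * (t * r)](_ : _ = t) ?mulrA.
  by ring.
by field; rewrite gt_eqF.
Qed.

Lemma normal_mgf_sqr (s lam : R) : 0 < s -> 2 * lam * s ^+ 2 < 1 ->
  (\int[normal_prob 0 s]_y (expR (lam * y ^+ 2))%:E =
   ((Num.sqrt (1 - 2 * lam * s ^+ 2))^-1)%:E)%E.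
Proof.
move=> s0 ls; pose r := Num.sqrt (1 - 2 * lam * s ^+ 2).
have r0 : 0 < r by rewrite sqrtr_gt0 subr_gt0.
have r2 : r ^+ 2 = 1 - 2 * lam * s ^+ 2 by rewrite sqr_sqrtr// subr_ge0 ltW.
rewrite ge0_integral_normal_prob//; last first.
  by apply: measurableT_comp => //; apply: measurable_funM.
rewrite -/r -[RHS]mule1 -(@integral_normal_pdf R 0 (s / r)).
rewrite -ge0_integralZl//; last 3 first.
- by apply/measurable_EFinP; exact: measurable_normal_pdf.
- by move=> y _; rewrite lee_fin normal_pdf_ge0.
- by rewrite lee_fin invr_ge0 ltW.
apply: eq_integral => y _; rewrite -EFinM; congr EFin.
exact: normal_pdf_tilt.
Qed.
End normal_mgf.

(** * Chi-square tails for the empirical variance in a fixed direction *)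

Lemma measurable_ge_set {R : realType} d (T : measurableType d) (f : T -> R)
    (a : R) : measurable_fun setT f -> measurable [set w | a <= f w].
Proof.
move=> mf; have := mf measurableT `[a, +oo[%classic (measurable_itv _).
rewrite setTI; congr (measurable _).
by apply/seteqP; split=> w; rewrite /= in_itv/= andbT.
Qed.

Lemma measurable_le_set {R : realType} d (T : measurableType d) (f : T -> R)
    (a : R) : measurable_fun setT f -> measurable [set w | f w <= a].
Proof.
move=> mf; have := mf measurableT `]-oo, a]%classic (measurable_itv _).
by rewrite setTI; congr (measurable _).
Qed.

Section chernoff.
Context {R : realType} d (T : measurableType d) (P : probability T R).
Context (m n : nat) (x : 'I_m -> {RV P >-> n.-tuple R}) (Sigma : 'M[R]_n).
Context (xS : gaussian_sample x Sigma).
Implicit Types u : 'cV[R]_n.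

Definition lin_form u (t : n.-tuple R) : R := (u^T *m vec t) 0 0.

Definition emp_var u (w : T) : R :=
  (u^T *m sample_cov (fun i => x i w) *m u) 0 0.

Lemma measurable_lin_form u : measurable_fun setT (lin_form u).
Proof.
rewrite /lin_form; under eq_fun do rewrite mxE.
apply: measurable_sum => j; under eq_fun do rewrite !mxE.
by apply: measurable_funM => //; exact: measurable_tnth.
Qed.

Lemma emp_varE u w : emp_var u w = m%:R^-1 * \sum_i lin_form u (x i w) ^+ 2.
Proof.
rewrite /emp_var /sample_cov -scalemxAr -scalemxAl mxE; congr (_ * _).
rewrite mulmx_sumr mulmx_suml summxE; apply: eq_bigr => i _.
rewrite (mulmxA u^T) -(mulmxA (u^T *m _)) [LHS]mxE big_ord1 expr2.
by congr (_ * _); rewrite dotmxC.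
Qed.

Lemma measurable_emp_var u : measurable_fun setT (emp_var u).
Proof.
rewrite (funext (emp_varE u)).
apply: measurable_funM => //; apply: measurable_sum => i.
apply: measurable_funX; apply: measurableT_comp; last exact: measurable_funP.
exact: measurable_lin_form.
Qed.

Lemma gaussian_exp_sqr u (s2 lam : R) i : (u^T *m Sigma *m u) 0 0 = s2 ->
  0 < s2 -> 2 * lam * s2 < 1 ->
  (\int[P]_w (expR (lam * lin_form u (x i w) ^+ 2))%:E =
   ((Num.sqrt (1 - 2 * lam * s2))^-1)%:E)%E.
Proof.
move=> uS s20 ls.
have s0 : 0 < Num.sqrt s2 by rewrite sqrtr_gt0.
have s22 : Num.sqrt s2 ^+ 2 = s2 by rewrite sqr_sqrtr// ltW.
rewrite -{1}s22 -normal_mgf_sqr ?s22//.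
have mX : measurable_fun setT (fun w => lin_form u (x i w)).
  apply: measurableT_comp; last exact: measurable_funP.
  exact: measurable_lin_form.
have m1 : measurable_fun setT (fun _ : T => 1 : R) by exact: measurable_cst.
rewrite (@ge0_integral_density_map R _ _ _ _ P (normal_prob 0 (Num.sqrt s2))
  (fun w => lin_form u (x i w)) (fun=> 1) mX m1).
- by apply: eq_integral => w _; rewrite mule1.
- by [].
- move=> B mB.
  have := (xS.2 i) u B mB; rewrite uS /centered_normal gt_eqF// => hE.
  rewrite integral_cst; last by rewrite -[X in measurable X]setTI; exact: mX.
  by rewrite mul1e; exact: esym hE.
- apply/measurable_EFinP; apply: measurableT_comp => //.
  by apply: measurable_funM.
- by move=> y; rewrite lee_fin expR_ge0.
Qed.

(** Exponential Markov inequality; the Laplace transform of the sum factorises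
    by independence. *)
Lemma chernoff u (s2 lam a : R) : (u^T *m Sigma *m u) 0 0 = s2 ->
  0 < s2 -> 2 * lam * s2 < 1 -> (0 < m)%N ->
  (P [set w | (a <= lam * m%:R * emp_var u w)%R] <=
   (expR (- a) * (Num.sqrt (1 - 2 * lam * s2))^-1 ^+ m)%:E)%E.
Proof.
move=> uS s20 ls m0.
pose A := [set w | (a <= lam * m%:R * emp_var u w)%R].
have mY : measurable_fun setT (fun w => lam * m%:R * emp_var u w).
  by apply: measurable_funM => //; exact: measurable_emp_var.
have mA : measurable A by exact: measurable_ge_set.
rewrite -/A -[X in P X]setIT -integral_indic//.
have prodE w : \prod_(i < m) expR (lam * lin_form u (x i w) ^+ 2) =
    expR (lam * m%:R * emp_var u w).
  rewrite -expR_sum -mulr_sumr emp_varE mulrA; congr (expR (_ * _)).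
  by rewrite mulfK// pnatr_eq0 -lt0n.
have mexp : measurable_fun setT (fun w => expR (lam * m%:R * emp_var u w)).
  exact: measurableT_comp.
have := @independent_prod R _ T P m n x xS.1
  (fun _ t => expR (lam * lin_form u t ^+ 2))
  (fun _ => (Num.sqrt (1 - 2 * lam * s2))^-1).
move=> /(_ _ _ _) h.
have {h} : (\int[P]_w (expR (lam * m%:R * emp_var u w))%:E =
    ((Num.sqrt (1 - 2 * lam * s2))^-1 ^+ m)%:E)%E.
  have cE : \prod_(i < m) (Num.sqrt (1 - 2 * lam * s2))^-1 =
      (Num.sqrt (1 - 2 * lam * s2))^-1 ^+ m by rewrite prodr_const card_ord.
  rewrite -cE -h.
  - by apply: eq_integral => w _; rewrite prodE.
  - move=> i; apply: measurableT_comp => //; apply: measurable_funM => //.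
    by apply: measurable_funX; exact: measurable_lin_form.
  - by move=> i t; exact: expR_ge0.
  - by move=> i; exact: gaussian_exp_sqr.
move=> intE; rewrite EFinM -intE -ge0_integralZl//; last exact/measurable_EFinP.
apply: ge0_le_integral => //.
- by apply/measurable_EFinP; exact: measurable_indic.
- apply: emeasurable_funM => //; exact/measurable_EFinP.
- move=> w _; rewrite -EFinM lee_fin -expRD indicE.
  case: (boolP (w \in A)) => [/set_mem wA|_]; last exact: expR_ge0.
  rewrite -[X in X <= _](expR0) ler_expR addrC subr_ge0; exact: wA.
Qed.

(** With r = sqrt (t / m), the choice lam = - r / s2 in [chernoff] gives the
    exponent - m r^2 = - t thanks to [expR_quad_le1D] at 2 r. *)
Lemma emp_var_lower_tail u (s2 t : R) : (u^T *m Sigma *m u) 0 0 = s2 ->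
  0 < s2 -> (0 < m)%N -> 0 <= t ->
  (P [set w | (emp_var u w <= s2 * (1 - 2 * Num.sqrt (t / m%:R)))%R] <=
   (expR (- t))%:E)%E.
Proof.
move=> uS s20 m0 t0; pose r := Num.sqrt (t / m%:R).
have mR : 0 < m%:R :> R by rewrite ltr0n.
have r0 : 0 <= r by exact: sqrtr_ge0.
have r2 : m%:R * r ^+ 2 = t.
  by rewrite sqr_sqrtr ?divr_ge0// mulrC divfK// gt_eqF.
pose lam := - r / s2; pose a := - r * m%:R * (1 - 2 * r).
have lsE : 2 * lam * s2 = - (2 * r) by rewrite /lam; field; rewrite gt_eqF.
have ls : 2 * lam * s2 < 1 by rewrite lsE; lra.
have := chernoff a uS s20 ls m0.
have -> : 1 - 2 * lam * s2 = 1 + 2 * r by rewrite lsE opprK.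
move=> hc.
apply: (@le_trans _ _ (P [set w | (a <= lam * m%:R * emp_var u w)%R])).
  apply: le_measure; rewrite ?inE.
  - exact/measurable_le_set/measurable_emp_var.
  - apply: measurable_ge_set; apply: measurable_funM => //.
    exact: measurable_emp_var.
  move=> w /= hw.
  have -> : a = lam * m%:R * (s2 * (1 - 2 * r)).
    by rewrite /a /lam; field; rewrite gt_eqF.
  rewrite ler_wnM2l// mulr_le0_ge0// ?ler0n//.
  by rewrite /lam mulr_le0_ge0 ?invr_ge0 ?oppr_le0// ltW.
apply: (le_trans hc); rewrite lee_fin.
have hb : expR (2 * (r - r ^+ 2)) <= 1 + 2 * r.
  have := @expR_quad_le1D R (2 * r).
  rewrite (_ : 2 * r - (2 * r) ^+ 2 / 2 = 2 * (r - r ^+ 2)).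
    by apply; rewrite mulr_ge0.
  by field.
have p0 : 0 < 1 + 2 * r by lra.
apply: (@le_trans _ _ (expR (- a) * expR (- (m%:R * (r - r ^+ 2))))).
  by rewrite ler_wpM2l ?expR_ge0// powV_sqrt_expR.
rewrite -expRD ler_expR -r2 /a; lra.
Qed.

(** [chernoff] with lam = s / 8 for the upper tail and lam = - s / 8 for the
    lower one; both exponents are m (x^2 - x s / 2) at x = s / 4. *)
Lemma emp_var_two_sided u (s : R) : (u^T *m Sigma *m u) 0 0 = 1 ->
  (0 < m)%N -> 0 <= s <= 2 ->
  (P [set w | (s <= `|emp_var u w - 1|)%R] <=
   (2 * expR (- (m%:R * s ^+ 2 / 16)))%:E)%E.
Proof.
move=> uS m0 /andP[s0 s2].
have mR : 0 < m%:R :> R by rewrite ltr0n.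
have one_side (s' : R) : `|s'| = s ->
    (P [set w | (s' * m%:R * (1 + s') / 8 <= s' / 8 * m%:R * emp_var u w)%R] <=
    (expR (- (m%:R * s ^+ 2 / 16)))%:E)%E.
  move=> s's.
  have s'2 : s' ^+ 2 = s ^+ 2 by rewrite -s's real_normK ?num_real.
  have s'h : `|s' / 4| <= 1 / 2 by rewrite normrM s's gtr0_norm//; lra.
  have ls : 2 * (s' / 8) * 1 < 1.
    have := ler_norm (s' / 4); lra.
  have := chernoff (s' * m%:R * (1 + s') / 8) uS ltr01 ls m0.
  have -> : 1 - 2 * (s' / 8) * 1 = 1 - s' / 4 by field.
  move=> /le_trans; apply; rewrite lee_fin.
  have p0 : 0 < 1 - s' / 4 by have := ler_norm (s' / 4); lra.
  have hb : expR (2 * - ((s' / 4 + 2 * (s' / 4) ^+ 2) / 2)) <= 1 - s' / 4.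
    rewrite mulrN mulrC divfK// expRN -[X in X <= _]mul1r.
    rewrite ler_pdivrMr ?expR_gt0//.
    exact: inv1B_le_expR.
  apply: (le_trans (ler_wpM2l (expR_ge0 _) (powV_sqrt_expR m p0 hb))).
  rewrite -expRD ler_expR -s'2; lra.
have mE : measurable_fun setT (emp_var u) by exact: measurable_emp_var.
have mS (s' : R) : measurable [set w |
    (s' * m%:R * (1 + s') / 8 <= s' / 8 * m%:R * emp_var u w)%R].
  by apply: measurable_ge_set; exact: measurable_funM.
have mabs : measurable [set w | (s <= `|emp_var u w - 1|)%R].
  apply: measurable_ge_set; apply: measurableT_comp => //.
  exact: measurable_funB.
apply: (@le_trans _ _ (P (
    [set w | (s * m%:R * (1 + s) / 8 <= s / 8 * m%:R * emp_var u w)%R] `|`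
    [set w |
      (- s * m%:R * (1 + - s) / 8 <= - s / 8 * m%:R * emp_var u w)%R]))).
  apply: le_measure; rewrite ?inE//; first exact: measurableU.
  move=> w /=; rewrite ler_normr => /orP[h|h]; [left|right].
    have : 0 <= s * m%:R * (emp_var u w - 1 - s).
      by rewrite !mulr_ge0// subr_ge0.
    lra.
  have : 0 <= s * m%:R * (- (emp_var u w - 1) - s).
    by rewrite !mulr_ge0// subr_ge0.
  lra.
apply: (le_trans (measureU2 _ _ _)) => //.
rewrite mulrDl mul1r EFinD leeD//; apply: one_side; first by rewrite ger0_norm.
by rewrite normrN ger0_norm.
Qed.
End chernoff.

(** * Bounds on vartheta *)

Section vartheta_bounds.
Context {R : realType}.
Local Notation N01 := (normal_prob (0 : R) 1).

Let hinge (c t : R) : R := Num.max (c * t ^+ 2 - 1) 0.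

Lemma hinge_ge0 c t : 0 <= hinge c t.
Proof. by rewrite le_max lexx orbT. Qed.

Lemma measurable_hinge c : measurable_fun setT (hinge c).
Proof.
apply: measurable_maxr => //; apply: measurable_funB => //.
exact: measurable_funM.
Qed.

(** The hinge is at most c t^2, and the second moment is read off the Laplace
    transform: from c t^2 + c / lam <= (c / lam) exp (lam t^2), the integral of
    c t^2 is at most (c / lam) ((1 - 2 lam)^(-1/2) - 1), which tends to c as lam
    tends to 0. *)
Lemma integral_hinge_le_approx (c lam : R) : 0 < c -> 0 < lam <= 1 / 8 ->
  (\int[N01]_t (hinge c t)%:E <= (c * (1 + 10 * lam))%:E)%E.
Proof.
move=> c0 /andP[l0 l8].
have mh : measurable_fun setT (EFin \o hinge c).
  by apply/measurable_EFinP; exact: measurable_hinge.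
have cl0 : 0 < c / lam by rewrite divr_gt0.
have key : (\int[N01]_t (hinge c t)%:E + (c / lam)%:E <=
    (c / lam * (Num.sqrt (1 - 2 * lam * 1 ^+ 2))^-1)%:E)%E.
  rewrite [leRHS]EFinM -normal_mgf_sqr//; last by rewrite expr1n; lra.
  rewrite -ge0_integralZl//; last 2 first.
  - apply/measurable_EFinP; apply: measurableT_comp => //.
    exact: measurable_funM.
  - by rewrite lee_fin ltW.
  have cstE : (\int[N01]_t (c / lam)%:E)%E = (c / lam)%:E.
    by rewrite integral_cst//= /normal_prob integral_normal_pdf mule1.
  rewrite -[X in (_ + X <= _)%E]cstE.
  rewrite -ge0_integralD//; last 2 first.
  - by move=> t _; rewrite lee_fin hinge_ge0.
  - by move=> t _; rewrite lee_fin ltW.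
  apply: ge0_le_integral => //.
  - by move=> t _; rewrite -EFinD lee_fin addr_ge0 ?hinge_ge0// ltW.
  - exact: emeasurable_funD.
  - apply: emeasurable_funM => //; apply/measurable_EFinP.
    by apply: measurableT_comp => //; exact: measurable_funM.
  move=> t _; rewrite -EFinM -EFinD lee_fin.
  have := expR_ge1Dx (lam * t ^+ 2) => he.
  apply: (@le_trans _ _ (c / lam * (1 + lam * t ^+ 2))); last first.
    by rewrite ler_pM2l.
  have -> : c / lam * (1 + lam * t ^+ 2) = c * t ^+ 2 + c / lam.
    by field; rewrite gt_eqF.
  rewrite lerD2r ge_max; apply/andP; split; first by rewrite gerBl.
  by rewrite mulr_ge0 ?sqr_ge0// ltW.
pose z := lam + 4 * lam ^+ 2.
have l2 : lam ^+ 2 <= lam / 8 by rewrite expr2 ler_wpM2l ?(ltW l0)//; lra.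
have l20 : 0 <= lam ^+ 2 by rewrite sqr_ge0.
have z1 : z < 1 by rewrite /z; lra.
have sqz : (Num.sqrt (1 - 2 * lam * 1 ^+ 2))^-1 <= (1 - z)^-1.
  rewrite expr1n mulr1.
  have := @powV_sqrt_expR R (1 - 2 * lam) (- z) 1.
  rewrite expr1 mul1r opprK => /(_ _ _) h.
  apply: (le_trans (h _ _)); first by lra.
    have hx : `|2 * lam| <= 1 / 2 by rewrite gtr0_norm; lra.
    have := inv1B_le_expR hx; rewrite mulrN expRN => hb.
    rewrite -[X in X <= _]mul1r ler_pdivrMr ?expR_gt0//.
    by apply: (le_trans hb); rewrite (_ : 2 * lam + _ = 2 * z)// /z; ring.
  have := expR_ge1Dx (- z); rewrite expRN => hz.
  by rewrite -[X in X <= _]invrK lef_pV2 ?posrE ?invr_gt0 ?expR_gt0//; lra.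
have fin : (\int[N01]_t (hinge c t)%:E <=
    (c / lam * (1 - z)^-1 - c / lam)%:E)%E.
  rewrite EFinB leeBrDr//; apply: (le_trans key).
  by rewrite lee_fin ler_pM2l.
apply: (le_trans fin); rewrite lee_fin.
have w0 : 0 < 1 - z by rewrite subr_gt0.
have -> : c / lam * (1 - z)^-1 - c / lam = c / lam * z / (1 - z).
  by field; rewrite !gt_eqF.
have -> : c / lam * z = c * (1 + 4 * lam) by rewrite /z; field; rewrite gt_eqF.
rewrite -mulrA ler_pM2l// ler_pdivrMr; last by lra.
have -> : (1 + 10 * lam) * (1 - z) =
    1 + 9 * lam - 14 * lam ^+ 2 - 40 * lam * lam ^+ 2.
  by rewrite /z; ring.
have : lam * lam ^+ 2 <= lam ^+ 2 / 8.
  by rewrite mulrC ler_wpM2l//; lra.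
lra.
Qed.

Lemma integral_hinge_le_id (c : R) : 0 < c ->
  (\int[N01]_t (hinge c t)%:E <= c%:E)%E.
Proof.
move=> c0; apply/lee_addgt0Pr => eps eps0.
pose lam := Num.min (1 / 8) (eps / (10 * c)).
have l0 : 0 < lam by rewrite lt_min divr_gt0//= divr_gt0// mulr_gt0.
have l8 : lam <= 1 / 8 by rewrite ge_min lexx.
have := @integral_hinge_le_approx c lam c0.
rewrite l0 l8 => /(_ isT) /le_trans; apply.
rewrite -EFinD lee_fin mulrDr mulr1 lerD2l mulrCA mulrA.
rewrite -ler_pdivlMl ?mulr_gt0//.
by rewrite mulrC ge_min lexx orbT.
Qed.

(** The hinge is at least 1 on an interval where c t^2 >= 2. *)
Lemma integral_hinge_gt0 (c : R) : 0 < c -> (0 < \int[N01]_t (hinge c t)%:E)%E.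
Proof.
move=> c0; pose a := Num.sqrt (2 / c).
have a2 : c * a ^+ 2 = 2.
  by rewrite sqr_sqrtr ?divr_ge0 ?(ltW c0)// mulrC divfK// gt_eqF.
have a0 : 0 <= a by rewrite sqrtr_ge0.
pose I : set R := `[a, a + 1]%classic.
have mI : measurable I by exact: measurable_itv.
pose k := normal_peak (1 : R) * expR (- (a + 1) ^+ 2 / (1 ^+ 2 *+ 2)).
have k0 : 0 < k by rewrite mulr_gt0 ?expR_gt0// normal_peak_gt0.
apply: (@lt_le_trans _ _ (N01 I)).
  apply: (@lt_le_trans _ _ k%:E); first by rewrite lte_fin.
  rewrite /normal_prob.
  have <- : (\int[lebesgue_measure]_(t in I) k%:E)%E = k%:E.
    rewrite integral_cst//= /I lebesgue_measure_itv/= lte_fin ltrDl ltr01.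
    by rewrite -EFinD addrAC subrr add0r mule1.
  apply: ge0_le_integral => //.
  - by move=> t _; rewrite lee_fin ltW.
  - by apply/measurable_EFinP/measurable_funTS; exact: measurable_normal_pdf.
  move=> t; rewrite /I/= in_itv/= => /andP[t1 t2].
  rewrite lee_fin normal_pdfE// /k /normal_fun subr0.
  rewrite ler_pM2l ?normal_peak_gt0//.
  rewrite ler_expR ler_pM2r ?invr_gt0 ?pmulrn_lgt0 ?expr1n//.
  by rewrite lerN2 lerXn2r// nnegrE; lra.
rewrite -[X in N01 X]setIT -integral_indic//.
apply: ge0_le_integral => //.
- by apply/measurable_EFinP; exact: measurable_indic.
- by apply/measurable_EFinP; exact: measurable_hinge.
move=> t _; rewrite lee_fin indicE.
case: (boolP (t \in I)) => [|_]; last exact: hinge_ge0.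
rewrite inE /I/= in_itv/= => /andP[t1 _]; rewrite le_max; apply/orP; left.
have : c * a ^+ 2 <= c * t ^+ 2.
  by rewrite ler_pM2l// lerXn2r// nnegrE (le_trans a0).
rewrite a2/=; lra.
Qed.

Lemma vartheta_bounds (c : R) : 0 < c -> 0 < vartheta c <= c.
Proof.
move=> c0; have h1 := integral_hinge_le_id c0; have h2 := integral_hinge_gt0 c0.
rewrite /vartheta /Rintegral.
have fin : (\int[N01]_t (hinge c t)%:E)%E \is a fin_num.
  by rewrite ge0_fin_numE ?(ltW h2)// (le_lt_trans h1)// ltry.
by rewrite -lte_fin -lee_fin fineK// h1 h2.
Qed.
End vartheta_bounds.

(** * The two error probabilities *)

Section detection.
Context {R : realType} d (T : measurableType d) (P : probability T R).
Context (m n : nat) (x : 'I_m -> {RV P >-> n.-tuple R}).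

Lemma psd_sample_cov (t : 'I_m -> n.-tuple R) : psd (sample_cov t).
Proof.
apply: psdZ; first by rewrite invr_ge0 ler0n.
elim/big_ind: _ => [|X Y|i _]; [exact: psd0|exact: psdD|].
by have := psd_gram (vec (t i))^T; rewrite trmxK.
Qed.

Lemma measurable_sample_cov i j :
  measurable_fun setT (fun w => sample_cov (fun k => x k w) i j).
Proof.
rewrite /sample_cov; under eq_fun do rewrite mxE summxE.
apply: measurable_funM => //; apply: measurable_sum => k.
under eq_fun do rewrite mxE big_ord1 !mxE.
by apply: measurable_funM; apply: (measurableT_comp (measurable_tnth _));
   exact: measurable_funP.
Qed.

Lemma measurable_psi_test (rho tau : R) : (0 < n)%N -> 0 <= rho -> 0 <= tau ->
  measurable [set w | psi_test rho tau (fun i => x i w)].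
Proof.
move=> n0 rho0 tau0; apply: measurable_lt_psi => //.
  by move=> w; exact: psd_sample_cov.
by move=> i j; exact: measurable_sample_cov.
Qed.

Lemma union_bound (I : Type) (r : seq I) (A : I -> set T) (b : R) :
  (forall i, measurable (A i)) -> (forall i, P (A i) <= b%:E)%E ->
  (P (\big[setU/set0]_(i <- r) A i) <= ((size r)%:R * b)%:E)%E.
Proof.
move=> mA hA; elim: r => [|i r IH]; first by rewrite big_nil measure0 mul0r.
rewrite big_cons /= -natr1 mulrDl mul1r addrC EFinD.
apply: (le_trans (measureU2 _ _ _)) => //; first exact: bigsetU_measurable.
by apply: leeD; [exact: hA|exact: IH].
Qed.

(** Union bound over the net. Net points are normalised before the tail bound is
    applied; the default direction for the zero vector is an arbitrary unit
    vector, so that all the events have the same bound. *)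
Lemma psi_test_null (rho tau s : R) : gaussian_sample x 1%:M ->
  (0 < m)%N -> (0 < n)%N -> 0 <= rho -> 0 <= s <= 2 -> 1 + 3 * s <= tau ->
  (P [set w | psi_test rho tau (fun i => x i w)] <=
   ((2 ^+ 18) ^+ n * (2 * expR (- (m%:R * s ^+ 2 / 16))))%:E)%E.
Proof.
move=> x1 m0 n0 rho0 /andP[s0 s2] stau.
have tau0 : 0 <= tau by lra.
pose q (z : grid n) := Num.sqrt (((grid_vec z : 'cV[R]_n)^T *m grid_vec z) 0 0).
pose u (z : grid n) : 'cV[R]_n :=
  if q z == 0 then delta_mx (Ordinal n0) 0 else (q z)^-1 *: grid_vec z.
have u1 z : ((u z)^T *m 1%:M *m u z) 0 0 = 1.
  rewrite mulmx1 /u; case: eqVneq => qz.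
    by rewrite trmx_delta mul_delta_mx mxE !eqxx.
  rewrite (_ : ((q z)^-1 *: grid_vec z)^T = (q z)^-1 *: (grid_vec z)^T).
    rewrite -!scalemxAl -scalemxAr scalerA mxE -expr2 exprVn.
    rewrite -[X in _ * X](@sqr_sqrtr _ _ (sumsqr_ge0 _)) -/(q z).
    by rewrite mulVf// expf_neq0.
  by rewrite linearZ.
pose A z := [set w | s <= `|emp_var x (u z) w - 1|].
have mA z : measurable (A z).
  apply: measurable_ge_set; apply: measurableT_comp => //.
  by apply: measurable_funB => //; exact: measurable_emp_var.
have hA z : (P (A z) <= (2 * expR (- (m%:R * s ^+ 2 / 16)))%:E)%E.
  by apply: (emp_var_two_sided x1) => //; rewrite s0 s2.
have hU := union_bound (enum (net n)) mA hA.
apply: (@le_trans _ _ (P (\big[setU/set0]_(z <- enum (net n)) A z)));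
  last first.
  apply: (le_trans hU); rewrite lee_fin ler_wpM2r ?mulr_ge0 ?expR_ge0//.
  by rewrite -cardE card_net.
apply: le_measure; rewrite ?inE.
- exact: measurable_psi_test.
- exact: bigsetU_measurable.
move=> w /= test; rewrite -bigcup_seq/=; apply: contrapT => nA.
have out z : z \in net n -> `|emp_var x (u z) w - 1| <= s.
  move=> zn; apply: contrapT => /negP; rewrite -ltNge => h; apply: nA.
  by exists z; rewrite /= ?mem_enum// /A/= ltW.
set S := sample_cov (fun i => x i w).
have Spsd : psd S by exact: psd_sample_cov.
have symW : (S - 1%:M)^T = S - 1%:M by rewrite linearB/= trmx1 (psd_sym Spsd).
have hnet (z : grid n) : z \in net n ->
    `|((grid_vec z)^T *m (S - 1%:M) *m grid_vec z) 0 0| <=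
     s * ((grid_vec z : 'cV[R]_n)^T *m grid_vec z) 0 0.
  move=> /out; rewrite /emp_var -/S.
  have [qz _|qz] := eqVneq (q z) 0.
    have -> : grid_vec z = 0 :> 'cV[R]_n.
      apply: sumsqr_eq0; rewrite -[LHS](@sqr_sqrtr _ _ (sumsqr_ge0 _)) -/(q z).
      by rewrite qz expr0n.
    by rewrite !mulmx0 mxE normr0 mulr0.
  have q0 : 0 < q z by rewrite lt_neqAle eq_sym qz sqrtr_ge0.
  rewrite /u (negbTE qz).
  rewrite (_ : ((q z)^-1 *: grid_vec z)^T = (q z)^-1 *: (grid_vec z)^T);
    last by rewrite linearZ.
  rewrite -!scalemxAl -scalemxAr scalerA mxE -expr2 exprVn.
  rewrite mulmxBr mulmxBl mulmx1 mx11D mx11N.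
  rewrite -[X in _ -> `|_ - X| <= s * X](@sqr_sqrtr _ _ (sumsqr_ge0 _)) -/(q z).
  set Q := ((grid_vec z)^T *m S *m grid_vec z) 0 0 => h.
  have -> : Q - q z ^+ 2 = q z ^+ 2 * ((q z ^+ 2)^-1 * Q - 1).
    by rewrite mulrBr mulr1 mulVKf// expf_neq0.
  by rewrite normrM ger0_norm ?sqr_ge0// mulrC ler_pM2r ?exprn_gt0.
have form := net_form n0 symW s0 hnet.
have := test; rewrite /psi_test -/S ltNge => /negP; apply.
apply: (psi_le_of_form n0 Spsd rho0 tau0 stau) => v.
have := form v; rewrite mulmxBr mulmxBl mulmx1 mx11D mx11N => h.
have := ler_norm ((v^T *m S *m v) 0 0 - (v^T *m v) 0 0); lra.
Qed.

Lemma psi_test_spiked (rho tau theta t : R) (v : 'cV[R]_n) :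
  gaussian_sample x (1%:M + theta *: (v *m v^T)) -> norm2 v = 1 ->
  (0 < m)%N -> (0 < n)%N -> 0 <= rho -> 0 <= tau -> 0 < theta -> 0 <= t ->
  tau + rho * (Card v)%:R <= (1 + theta) * (1 - 2 * Num.sqrt (t / m%:R)) ->
  (P [set w | ~~ psi_test rho tau (fun i => x i w)] <= (expR (- t))%:E)%E.
Proof.
move=> xv v1 m0 n0 rho0 tau0 th0 t0 htau.
have vv : (v^T *m v) 0 0 = 1.
  move/(congr1 (fun y => y ^+ 2)): v1; rewrite /norm2 sqr_sqrtr ?expr1n.
    by move=> <-; rewrite mxE; apply: eq_bigr => i _; rewrite mxE expr2.
  by rewrite sumr_ge0// => i _; rewrite sqr_ge0.
have vS : (v^T *m (1%:M + theta *: (v *m v^T)) *m v) 0 0 = 1 + theta.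
  rewrite mulmxDr mulmxDl mulmx1 mx11D vv -scalemxAr -scalemxAl [X in _ + X]mxE.
  have -> : v^T *m (v *m v^T) *m v = (v^T *m v) *m (v^T *m v).
    by rewrite !mulmxA.
  by rewrite [X in _ * X]mxE big_ord1 vv !mulr1.
apply: (le_trans _ (emp_var_lower_tail xv vS _ m0 t0)); last lra.
apply: le_measure; rewrite ?inE.
- have := measurableC (measurable_psi_test n0 rho0 tau0).
  by congr (measurable _); apply/seteqP; split=> w /= /negP.
- exact/measurable_le_set/measurable_emp_var.
move=> w /= ntest; rewrite leNgt; apply: contraNN ntest => h.
apply: (lt_psi_of_form n0 (psd_sample_cov _) rho0 tau0 v1).
exact: le_lt_trans htau h.
Qed.
End detection.

(** * The levels of the test and the theorem *)

Section constants.
Context {R : realType}.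

Lemma e_gt0 : 0 < (e : R).
Proof. exact: expR_gt0. Qed.

Lemma Delta_ge (n : nat) (kappa delta : R) : (0 < n)%N -> 0 < kappa < 1 ->
  4 * ln (1 / delta) <= Delta n (kappa * n%:R) delta.
Proof.
move=> n0 /andP[k0 k1]; have nR : 0 < n%:R :> R by rewrite ltr0n.
rewrite lerDr mulr_ge0//; apply: ln_ge0.
rewrite ler_pdivlMr ?mulr_gt0// mul1r ler_wpM2r ?ler0n//.
have := expR_ge1Dx (1 : R); rewrite -/e; lra.
Qed.

(** The penalty paid by a vector with k nonzero entries, in the form in which it
    enters tau1. *)
Lemma rho_mul (m n : nat) (k delta : R) : (0 < m)%N -> 0 < k ->
  0 < Delta n k delta ->
  let D := Delta n k delta in
  rho m n k delta * k =
    k * D / m%:R + Num.sqrt (k * D / (m%:R * (1 + 4 / (e * D)))).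
Proof.
move=> m0 k0 D0 D; rewrite /rho -/D mulrDl.
have mR : 0 < m%:R :> R by rewrite ltr0n.
have e0 := e_gt0.
have F0 : 0 < D + 4 / e by rewrite addr_gt0// divr_gt0.
have W0 : 0 < k * m%:R * (D + 4 / e) by rewrite !mulr_gt0.
congr (_ + _); first by rewrite mulrC mulrA.
have -> : k * D / (m%:R * (1 + 4 / (e * D))) =
    (D * k) ^+ 2 / (k * m%:R * (D + 4 / e)).
  field; do ?[apply/andP; split]; rewrite ?gt_eqF//.
  by rewrite addr_gt0// mulr_gt0.
rewrite [RHS]sqrtrM ?sqr_ge0// sqrtr_sqr gtr0_norm ?mulr_gt0//.
by rewrite sqrtrV ?(ltW W0)// mulrAC.
Qed.

(** The denominator of c is positive, and its numerator is at most
    1 - mu D kappa. *)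
Lemma c_beta_gt0_lt (mu kappa delta : R) (m n : nat) : 0 < mu -> 0 < kappa ->
  let D := Delta n (kappa * n%:R) delta in 0 < D ->
  0 < c_beta mu kappa m n delta -> mu * D * kappa < 1.
Proof.
move=> mu0 k0 D D0; rewrite /c_beta -/D.
have e0 := e_gt0.
have F0 : 0 < D + 4 / e by rewrite addr_gt0// divr_gt0.
have den0 : 0 < mu * D + mu * D / Num.sqrt (kappa * (D + 4 / e)).
  have muD : 0 < mu * D by exact: mulr_gt0.
  by rewrite addr_gt0// divr_gt0// sqrtr_gt0 mulr_gt0.
rewrite pmulr_lgt0 ?invr_gt0// => num0.
have : 0 <= Num.sqrt (mu * kappa) / Num.sqrt (D + 4 / e).
  by rewrite divr_ge0 ?sqrtr_ge0.
have := sqrtr_ge0 (ln (1 / delta) / m%:R); lra.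
Qed.

Lemma tau0_ge (m n : nat) (mu kappa delta : R) : (0 < m)%N -> 0 < mu ->
  0 < kappa -> n%:R = mu * m%:R ->
  let D := Delta n (kappa * n%:R) delta in 0 < D ->
  1 + Num.sqrt (mu * D * kappa) <= tau0 m n (kappa * n%:R) delta.
Proof.
move=> m0 mu0 k0 nE D D0; rewrite /tau0 -/D.
have mR : 0 < m%:R :> R by rewrite ltr0n.
have nR : 0 <= n%:R :> R by rewrite ler0n.
have e0 := e_gt0.
have F0 : 0 < 4 / e :> R by rewrite divr_gt0.
have h1 : Num.sqrt (mu * D * kappa) <=
    Num.sqrt (kappa * n%:R * (D + 4 / e) / m%:R).
  rewrite ler_wsqrtr// nE.
  have -> : kappa * (mu * m%:R) * (D + 4 / e) / m%:R = kappa * mu * (D + 4 / e).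
    by field; rewrite !gt_eqF.
  have := mulr_gt0 (mulr_gt0 k0 mu0) F0; lra.
have h2 : 0 <= 4 * (kappa * n%:R) / (e * m%:R).
  by apply: divr_ge0; rewrite !mulr_ge0 ?(ltW k0) ?(ltW e0).
have h3 : 0 <= 4 / (e * D) *
    Num.sqrt (kappa * n%:R * D / (m%:R * (1 + 4 / (e * D)))).
  by apply: mulr_ge0; rewrite ?sqrtr_ge0// divr_ge0// ltW// mulr_gt0.
lra.
Qed.

(** The exponent is n kappa D / 144. Half of it, kappa D being at least
    4 * 72 * 19, absorbs the 2^(18 n) points of the net and the factor 2; the
    other half, kappa n being at least 72, is at least ln (1/delta). *)
Lemma net_tail_le (m n : nat) (mu kappa delta D : R) : 0 < mu -> 0 < kappa ->
  (0 < m)%N -> (0 < n)%N -> n%:R = mu * m%:R -> 72 / kappa <= n%:R ->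
  0 < delta -> delta < expR (- (72 * 19 / kappa)) -> 4 * ln (1 / delta) <= D ->
  (2 ^+ 18) ^+ n *
    (2 * expR (- (m%:R * (Num.sqrt (mu * D * kappa) / 3) ^+ 2 / 16))) <= delta.
Proof.
move=> mu0 k0 m0 n0 nE nk d0 dd0 LD.
have nR : 1 <= n%:R :> R by rewrite ler1n.
have e2 : (2 : R) <= expR 1 by have := expR_ge1Dx (1 : R); lra.
have L1 : 72 * 19 / kappa <= ln (1 / delta).
  rewrite -(expRK (72 * 19 / kappa)) ler_ln ?posrE ?expR_gt0 ?divr_gt0//.
  by rewrite -[X in X <= _]invrK -expRN div1r lef_pV2 ?posrE ?expR_gt0// ltW.
set L := ln (1 / delta) in LD L1.
have dE : delta = expR (- L).
  by rewrite expRN /L lnK ?posrE ?divr_gt0// div1r invrK.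
have kL : 72 * 19 <= kappa * L.
  by move: L1; rewrite ler_pdivrMr// (mulrC L).
have kn : 72 <= kappa * n%:R by move: nk; rewrite ler_pdivrMr// mulrC.
have L0 : 0 <= L.
  by apply: le_trans L1; rewrite divr_ge0 ?(ltW k0)// mulr_ge0 ?ler0n.
have kD : kappa * (4 * L) <= kappa * D by rewrite ler_pM2l.
have D0 : 0 <= D by apply: le_trans LD; rewrite mulr_ge0.
have expoE : m%:R * (Num.sqrt (mu * D * kappa) / 3) ^+ 2 / 16 =
    n%:R * (kappa * D) / 144.
  rewrite expr_div_n sqr_sqrtr; last by rewrite !mulr_ge0 ?(ltW mu0) ?(ltW k0).
  by rewrite nE; field.
rewrite expoE.
apply: (@le_trans _ _ (expR (18 * n%:R + 1 - n%:R * (kappa * D) / 144))).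
  rewrite expRD expRD -[leRHS]mulrA ler_pM ?mulr_ge0 ?exprn_ge0 ?expR_ge0//.
    have -> : 18 * n%:R = (18 * n)%:R * 1 :> R by rewrite natrM mulr1.
    by rewrite -exprM expRM_natl lerXn2r ?nnegrE ?expR_ge0.
  by rewrite ler_wpM2r ?expR_ge0.
rewrite dE ler_expR.
have h1 : n%:R * (72 * 19 * 4) <= n%:R * (kappa * D).
  by rewrite ler_wpM2l ?ler0n//; lra.
have h2 : 72 * (4 * L) <= n%:R * (kappa * D).
  apply: (@le_trans _ _ (n%:R * (kappa * (4 * L)))).
    by rewrite [leRHS]mulrCA [leRHS]mulrA ler_wpM2r// mulr_ge0.
  by rewrite ler_wpM2l// ler0n.
lra.
Qed.
End constants.

Theorem theorem4p5 (R : realType) (kappa : R) (hkappa : 0 < kappa < 1) :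
  exists2 delta0 : R, 0 < delta0 &
  forall mu : R, 0 < mu ->
  exists N : nat,
  forall m n : nat, (N <= n)%N -> n%:R = mu * m%:R ->
  forall delta : R, 0 < delta < 1 -> delta < delta0 ->
  forall kstar : R, kstar = kappa * n%:R ->
  0 < c_beta mu kappa m n delta ->
  forall theta_psi : R,
    (beta mu kappa m n delta)^-1 * theta_phi m n kstar delta <= theta_psi ->
  forall theta : R, 0 < theta -> theta_psi < theta ->
  forall tau_psi : R,
    (beta mu kappa m n delta)^-1 * tau0 m n kstar delta <= tau_psi
      <= tau1 m n kstar delta theta ->
  forall v : 'cV[R]_n, norm2 v = 1 -> (Card v)%:R <= kstar ->
  forall (d0 : measure_display) (T0 : measurableType d0)
    (P0 : probability T0 R) (x : 'I_m -> {RV P0 >-> n.-tuple R}),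
    gaussian_sample x 1%:M ->
  forall (d1 : measure_display) (T1 : measurableType d1)
    (P1 : probability T1 R) (y : 'I_m -> {RV P1 >-> n.-tuple R}),
    gaussian_sample y (1%:M + theta *: (v *m v^T)) ->
  (P0 [set w | psi_test (rho m n kstar delta) tau_psi (fun i => x i w)]
   + P1 [set w | ~~ psi_test (rho m n kstar delta) tau_psi (fun i => y i w)]
   <= (3 * delta)%:E)%E.
Proof.
have /andP[k0 k1] := hkappa.
(* delta0 makes kappa D at least 4 * 72 * 19, and the threshold on n makes
   kappa n at least 72, as [net_tail_le] requires. *)
exists (expR (- (72 * 19 / kappa))); first exact: expR_gt0.
move=> mu mu0; exists (Num.truncn (72 / kappa)).+1.
move=> m n Nn nE delta /andP[d0 d1] dd0 _ -> c0 _ _ theta th0 _ tau.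
move=> /andP[tau_lo tau_hi] v v1 cardv dd T0 P0 x x1 dd' T1 P1 y yv.
have n0 : (0 < n)%N by exact: leq_ltn_trans Nn.
have nR : 0 < n%:R :> R by rewrite ltr0n.
have m0 : (0 < m)%N.
  by move: nR; rewrite nE pmulr_rgt0// ltr0n.
have mR : 0 < m%:R :> R by rewrite ltr0n.
have nk : 72 / kappa <= n%:R.
  apply/ltW/(lt_le_trans (truncnS_gt _)); by rewrite ler_nat.
have L0 : 0 < ln (1 / delta).
  by rewrite ln_gt0// div1r invf_gt1.
set D := Delta n (kappa * n%:R) delta.
have LD : 4 * ln (1 / delta) <= D by exact: Delta_ge.
have D0 : 0 < D by apply: lt_le_trans LD; rewrite mulr_gt0.
have ks0 : 0 < kappa * n%:R by rewrite mulr_gt0.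
have muD : mu * D * kappa < 1 by exact: c_beta_gt0_lt c0.
have muD0 : 0 <= mu * D * kappa by rewrite ltW// !mulr_gt0.
(* The factor 3 is the one lost when passing from the net to the sphere. *)
set s := Num.sqrt (mu * D * kappa) / 3.
have s02 : 0 <= s <= 2.
  rewrite divr_ge0 ?sqrtr_ge0//= ler_pdivrMr//.
  have : Num.sqrt (mu * D * kappa) <= Num.sqrt 1 by rewrite ler_wsqrtr// ltW.
  by rewrite sqrtr1; lra.
have beta1 : 1 <= (beta mu kappa m n delta)^-1.
  have /andP[v0 vc] := vartheta_bounds c0.
  rewrite /beta/= invf_ge1; last exact: divr_gt0.
  by rewrite ler_pdivrMr// mul1r.
have t0ge := tau0_ge m0 mu0 k0 nE D0.
have t00 : 0 <= tau0 m n (kappa * n%:R) delta.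
  by apply: le_trans t0ge; rewrite addr_ge0// sqrtr_ge0.
have stau : 1 + 3 * s <= tau.
  apply: le_trans tau_lo.
  apply: (@le_trans _ _ (tau0 m n (kappa * n%:R) delta)).
    by rewrite /s mulrC divfK.
  by rewrite ler_peMl.
have tau_ge0 : 0 <= tau by move/andP: s02 => [? ?]; lra.
have rho0 : 0 <= rho m n (kappa * n%:R) delta.
  by rewrite addr_ge0// divr_ge0 ?sqrtr_ge0// ltW.
have err0 := psi_test_null x1 m0 n0 rho0 s02 stau.
have err1 : (P1 [set w | ~~ psi_test (rho m n (kappa * n%:R) delta) tau
    (fun i => y i w)] <= delta%:E)%E.
  have -> : delta = expR (- ln (1 / delta)).
    by rewrite expRN lnK ?posrE ?divr_gt0// div1r invrK.
  rewrite [X in rho _ _ _ X](_ : _ = delta); last first.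
    by rewrite expRN lnK ?posrE ?divr_gt0// div1r invrK.
  apply: (psi_test_spiked yv v1 m0 n0 rho0 tau_ge0 th0 (ltW L0)).
  apply: (@le_trans _ _ (tau + rho m n (kappa * n%:R) delta * (kappa * n%:R))).
    by rewrite lerD2l ler_wpM2l.
  rewrite (rho_mul m0 ks0 D0) -/D.
  move: tau_hi; rewrite /tau1 -/D; lra.
apply: (@le_trans _ _ (delta%:E + delta%:E)%E).
  apply: leeD err1; apply: (le_trans err0); rewrite lee_fin.
  exact: net_tail_le.
by rewrite -EFinD lee_fin; lra.
Qed.
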